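(* Let $d\geq2$. Then there is $\alpha_0=\alpha_0(d)>0$ with the following property: let $a>0$ and let $\omega\colon(0,a)\to(0,\infty)$ be injective of the form $$\omega(t)=t\left(\log\frac1t\right)^{\alpha_0}.$$ Then there is a continuous function $\rho\colon[0,1]^d\to(0,\infty)$ for which the pushforward equation $$f_\sharp(\rho\mathcal{L})=\mathcal{L}|_{f([0,1]^d)}$$ admits no injective solution $f\colon[0,1]^d\to\mathbb{R}^d$ that is a bi-$\omega$-mapping.
   Context: $\mathcal{L}$ is the $d$-dimensional Lebesgue measure, $\rho\mathcal{L}$ is the measure $S\mapsto\int_S\rho\,\mathrm{d}\mathcal{L}$ on $[0,1]^d$, $f_\sharp\nu(S):=\nu(f^{-1}(S))$ is the pushforward of a measure $\nu$, and $\mathcal{L}|_{E}$ is the restriction of $\mathcal{L}$ to $E$. Given a strictly increasing function $\omega\colon(0,a)\to(0,\infty)$ with $\lim_{t\to0}\omega(t)=0$, a mapping $f\colon A\subseteq\mathbb{R}^d\to\mathbb{R}^k$ is called an $\omega$-mapping ($\omega$-continuous) if there is $K>0$ such that $\|f(y)-f(x)\|_2\leq K\omega(\|y-x\|_2)$ for all $x,y\in A$ with $0<\|y-x\|_2<a$. An injective mapping $f\colon A\to\mathbb{R}^k$ is a bi-$\omega$-mapping if both $f$ and $f^{-1}\colon f(A)\to A$ are $\omega$-continuous. *)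

(* Defs.v *)
From HB Require Import structures.
From mathcomp Require Import all_boot all_order all_algebra.
From mathcomp Require Import all_classical all_reals all_analysis.
From mathcomp Require Import measurable_realfun.

Set Implicit Arguments.
Unset Strict Implicit.
Unset Printing Implicit Defensive.
Import Order.TTheory GRing.Theory Num.Theory.
Import numFieldNormedType.Exports.

Local Open Scope classical_set_scope.
Local Open Scope ring_scope.

(* R^n carries the Borel sigma-algebra *)
HB.instance Definition _ (R : realType) (n : nat) :=
  @isMeasurable.Build (sigma_display (@open 'rV[R]_n)) 'rV[R]_n <<s @open 'rV[R]_n >>
    (@sigma_algebra0 _ setT (@open 'rV[R]_n)) (@sigma_algebraC _ (@open 'rV[R]_n))
    (@sigma_algebra_bigcup _ setT (@open 'rV[R]_n)).

Section lebesgue.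
Context {R : realType}.

(* R * R^n -> R^(n+1); 'rV_(1 + n) is convertible to 'rV_n.+1 *)
Definition consrV n (p : measurableTypeR R * 'rV[R]_n) : 'rV[R]_n.+1 :=
  row_mx (p.1 : R)%:M p.2 : 'rV[R]_(1 + n).

(* n-dimensional Lebesgue measure on the Borel sets of R^n, as the n-fold
   product of lebesgue_measure *)
Fixpoint lebesgue_rV n : set 'rV[R]_n -> \bar R :=
  match n with
  | 0 => \d_(0 : 'rV[R]_0)
  | n'.+1 => pushforward (lebesgue_measure \x @lebesgue_rV n')%E (@consrV n')
  end.

Lemma open_measurable_rV n (U : set 'rV[R]_n) : open U -> measurable U.
Proof. exact: sub_sigma_algebra. Qed.

Lemma measurable_coord_rV n (i : 'I_n) :
  measurable_fun setT (fun v : 'rV[R]_n => v 0 i : measurableTypeR R).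
Proof.
apply: (measurability _ (RGenOpens.measurableE R)) => _ [_ [a [b ->] <-]].
rewrite setTI; apply: open_measurable_rV.
apply: (@open_comp _ _ (fun v : 'rV[R]_n => v 0 i)); last exact: interval_open.
by move=> v _; exact: coord_continuous.
Qed.

Lemma measurable_fun_rVP d (T : measurableType d) n (f : T -> 'rV[R]_n) :
  measurable_fun setT f <->
  forall i, measurable_fun setT (fun t => f t 0 i : measurableTypeR R).
Proof.
split=> [mf i|mf].
  exact: (measurableT_comp (measurable_coord_rV i) mf).
apply: (@measurability _ _ _ _ setT f (@open 'rV[R]_n)) => //.
move=> _ [U oU <-]; rewrite setTI.
pose box (qk : 'rV[rat]_n * nat) : set 'rV[R]_n :=
  [set v | forall i, `|v 0 i - ratr (qk.1 0 i)| < qk.2.+1%:R^-1].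
have -> : f @^-1` U =
    \bigcup_qk (if `[< box qk `<=` U >] then f @^-1` (box qk) else set0).
  apply/seteqP; split=> [t /= Uft|t [qk _]]; last first.
    by case: asboolP => // + b; exact.
  have : nbhs (f t) U by exact: open_nbhs_nbhs.
  rewrite -nbhs_ballE => -[e /= e0 eU].
  have e20 : 0 < e / 2 by rewrite divr_gt0.
  have [k ke] : exists k : nat, k.+1%:R^-1 < e / 2.
    have [k _ /(_ _ (leqnn _)) ke] := near_infty_natSinv_lt (PosNum e20).
    by exists k.
  have k0 : 0 < k.+1%:R^-1 :> R by rewrite invr_gt0 ltr0n.
  have /choice[q qP] : forall i : 'I_n, exists q : rat,
      `|f t 0 i - ratr q| < k.+1%:R^-1.
    move=> i.
    have /rat_in_itvoo[q] : f t 0 i - k.+1%:R^-1 < f t 0 i + k.+1%:R^-1.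
      by rewrite ltrD2l gtrN.
    rewrite in_itv/= => /andP[q1 q2]; exists q.
    by rewrite distrC ltr_distl q1.
  exists (\row_i q i, k) => //=; rewrite asboolT/=.
    by move=> i; rewrite mxE; exact: qP.
  move=> v bv; apply: eU; split=> // i j; rewrite ord1 /ball/=.
  have {}bv := bv j; rewrite /= mxE in bv.
  rewrite -(subrKA (ratr (q j))) (le_lt_trans (ler_normD _ _))//.
  rewrite [ltRHS]splitr ltrD//; first exact: lt_trans ke.
  by rewrite distrC (lt_trans bv).
apply: countable_bigcupT_measurable => // qk.
case: ifP => // _.
have -> : f @^-1` box qk = \big[setI/setT]_(i < n)
    (fun t => f t 0 i : measurableTypeR R) @^-1`
      (ball (ratr (qk.1 0 i) : R) (qk.2.+1%:R^-1 : R)).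
  rewrite -bigcap_seq; apply/seteqP; split => t /= h i.
    by move=> _; rewrite /ball/= distrC; exact: h.
  by have := h i (mem_index_enum _); rewrite /ball/= distrC.
apply: bigsetI_measurable => i _; rewrite -[X in measurable X]setTI.
apply: mf => //.
apply: open_measurable; exact: ball_open.
Qed.

Lemma measurable_consrV n : measurable_fun setT (@consrV n).
Proof.
apply/measurable_fun_rVP => i; case: (@splitP 1 n i) => j ij.
  rewrite (_ : (fun _ => _) = fst); first exact: measurable_fst.
  apply/funext => p; rewrite (_ : i = @lshift 1 n j); last exact: val_inj.
  by rewrite [LHS](@row_mxEl _ 1 1 n) ord1 mxE eqxx mulr1n.
rewrite (_ : (fun _ => _) = (fun v : 'rV[R]_n => v 0 j) \o snd).
  exact: (measurableT_comp (measurable_coord_rV j) measurable_snd).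
apply/funext => p; rewrite (_ : i = @rshift 1 n j); last exact: val_inj.
by rewrite [LHS](@row_mxEr _ 1 1 n).
Qed.

Let unconsrV n (v : 'rV[R]_n.+1) : measurableTypeR R * 'rV[R]_n :=
  (v 0 0, rsubmx (v : 'rV[R]_(1 + n))).

Let unconsrVK n : cancel (@unconsrV n) (@consrV n).
Proof.
move=> v; rewrite /consrV -[RHS](@hsubmxK _ 1 1 n); congr (@row_mx _ 1 1 n _ _).
by apply/rowP => j; rewrite !mxE ord1 eqxx mulr1n; congr (v _ _); exact: val_inj.
Qed.

Let consrVK n : cancel (@consrV n) (@unconsrV n).
Proof.
move=> [x v]; rewrite /consrV /unconsrV; congr pair; last exact: (@row_mxKr _ 1 1 n).
rewrite (_ : 0 = @lshift 1 n ord0 :> 'I_n.+1); last exact: val_inj.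
by rewrite [LHS](@row_mxEl _ 1 1 n) mxE eqxx mulr1n.
Qed.

Let measurable_unconsrV n : measurable_fun setT (@unconsrV n).
Proof.
apply/measurable_fun_pairP; split; first exact: measurable_coord_rV.
apply/measurable_fun_rVP => i.
rewrite (_ : (fun _ => _) = fun v : 'rV[R]_n.+1 => v 0 (@rshift 1 n i)).
  exact: measurable_coord_rV.
by apply/funext => v /=; rewrite mxE.
Qed.

Section step.
Local Open Scope ereal_scope.
Variables (n : nat) (mu : {sigma_finite_measure set 'rV[R]_n -> \bar R}).

Definition lebesgue_rV_step : set 'rV[R]_n.+1 -> \bar R :=
  pushforward (lebesgue_measure \x mu) (@consrV n).

Let preimage_measurable A : measurable A -> measurable (@consrV n @^-1` A).
Proof.
by move=> mA; rewrite -[X in measurable X]setTI; exact: measurable_consrV.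
Qed.

Let step0 : lebesgue_rV_step set0 = 0.
Proof. by rewrite /lebesgue_rV_step /pushforward preimage_set0 measure0. Qed.

Let step_ge0 A : 0 <= lebesgue_rV_step A.
Proof. by rewrite /lebesgue_rV_step /pushforward measure_ge0. Qed.

Let step_sigma_additive : semi_sigma_additive lebesgue_rV_step.
Proof.
move=> F mF tF mUF; rewrite /lebesgue_rV_step /pushforward preimage_bigcup.
apply: measure_semi_sigma_additive.
- by move=> k; exact: preimage_measurable.
- apply/trivIsetP => /= i j _ _ ij; rewrite -preimage_setI.
  by move/trivIsetP : tF => /(_ _ _ _ _ ij) ->//; rewrite preimage_set0.
- by rewrite -preimage_bigcup; exact: preimage_measurable.
Qed.

HB.instance Definition _ := isMeasure.Build _ _ _ lebesgue_rV_step
  step0 step_ge0 step_sigma_additive.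

Let step_sigma_finite : sigma_finite setT lebesgue_rV_step.
Proof.
have /sigma_finiteP[F [TF ndF Foo]] := sigma_finiteT (@lebesgue_measure R).
have /sigma_finiteP[G [TG ndG Goo]] := sigma_finiteT mu.
exists (fun k => @unconsrV n @^-1` (F k `*` G k)).
  rewrite -preimage_bigcup; apply/seteqP; split=> // v _ /=.
  have [i _ Fi] : (\bigcup_i F i) (unconsrV v).1 by rewrite -TF.
  have [j _ Gj] : (\bigcup_i G i) (unconsrV v).2 by rewrite -TG.
  exists (maxn i j) => //; split.
    by move: Fi; apply/subsetPset/ndF/leq_maxl.
  by move: Gj; apply/subsetPset/ndG/leq_maxr.
move=> k; have [mF Fk] := Foo k; have [mG Gk] := Goo k; split.
  rewrite -[X in measurable X]setTI; apply: measurable_unconsrV => //.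
  exact: measurableX.
rewrite /lebesgue_rV_step /pushforward -comp_preimage (_ : _ \o _ = id).
  by rewrite preimage_id product_measure1E// lte_mul_pinfty// ge0_fin_numE.
by apply/funext => p; exact: consrVK.
Qed.

HB.instance Definition _ := Measure_isSigmaFinite.Build _ _ _ lebesgue_rV_step
  step_sigma_finite.

End step.

Let lebesgue_rV_spec n : {mu : {sigma_finite_measure set 'rV[R]_n -> \bar R} |
  @lebesgue_rV n = mu}.
Proof.
elim: n => [|n [mu muE]]; first by exists (\d_(0 : 'rV[R]_0)).
by exists (lebesgue_rV_step mu); rewrite /= muE.
Qed.

Let lebesgue_rV0 n : @lebesgue_rV n set0 = 0%E.
Proof. by have [mu ->] := lebesgue_rV_spec n; exact: measure0. Qed.

Let lebesgue_rV_ge0 n A : (0 <= @lebesgue_rV n A)%E.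
Proof. by have [mu ->] := lebesgue_rV_spec n; exact: measure_ge0. Qed.

Let lebesgue_rV_sigma_additive n : semi_sigma_additive (@lebesgue_rV n).
Proof.
by have [mu ->] := lebesgue_rV_spec n; exact: measure_semi_sigma_additive.
Qed.

HB.instance Definition _ n := isMeasure.Build _ _ _ (@lebesgue_rV n)
  (lebesgue_rV0 n) (@lebesgue_rV_ge0 n) (@lebesgue_rV_sigma_additive n).

Let lebesgue_rV_sigma_finite n : sigma_finite setT (@lebesgue_rV n).
Proof. by have [mu ->] := lebesgue_rV_spec n; exact: sigma_finiteT. Qed.

HB.instance Definition _ n := Measure_isSigmaFinite.Build _ _ _ (@lebesgue_rV n)
  (@lebesgue_rV_sigma_finite n).

Lemma lebesgue_rV_prod n (A : 'I_n -> set (measurableTypeR R)) :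
  (forall i, measurable (A i)) ->
  lebesgue_rV [set v : 'rV[R]_n | forall i, A i (v 0 i)] =
  (\prod_(i < n) lebesgue_measure (A i))%E.
Proof.
elim: n A => [|n IHn] A mA.
  rewrite big_ord0 /= diracE mem_set// => i; by case: i.
rewrite big_ord_recl /= -IHn// -product_measure1E//; last first.
  have -> : [set v : 'rV[R]_n | forall i, A (lift ord0 i) (v 0 i)] =
      \big[setI/setT]_(i < n) ((fun v : 'rV[R]_n => v 0 i : measurableTypeR R)
        @^-1` A (lift ord0 i)).
    rewrite -bigcap_seq; apply/seteqP; split => v /= h i; first by move=> _.
    exact: h i (mem_index_enum _).
  apply: bigsetI_measurable => i _; rewrite -[X in measurable X]setTI.
  exact: measurable_coord_rV.
rewrite /pushforward; congr product_measure1.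
apply/seteqP; split=> [[x v]/= h|[x v]/= [h1 h2] i].
  split.
    have := h ord0; congr (A _ _).
    exact: (congr1 fst (consrVK (x, v))).
  move=> i; have := h (lift ord0 i); congr (A _ _).
  rewrite (_ : lift ord0 i = @rshift 1 n i); last exact: val_inj.
  exact: (@row_mxEr _ 1 1 n).
have [->|] := eqVneq i ord0.
  by rewrite [X in A _ X](congr1 fst (consrVK (x, v))).
case: (unliftP ord0 i) => [j -> _|->]; last by rewrite eqxx.
rewrite (_ : consrV _ _ _ = v 0 j)//.
rewrite (_ : lift ord0 j = @rshift 1 n j); last exact: val_inj.
exact: (@row_mxEr _ 1 1 n).
Qed.

End lebesgue.

Section bi_omega.
Context {R : realType}.

(* the library norm `|v| on 'rV[R]_n is the sup norm *)
Definition norm2 n (v : 'rV[R]_n) : R := Num.sqrt (\sum_i v 0 i ^+ 2).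

Definition unit_cube d : set 'rV[R]_d := [set v | forall i, 0 <= v 0 i <= 1].
Arguments unit_cube : clear implicits.

(* Only the values of omega on ]0, a[ and of f on A matter. *)
Definition omega_mapping (a : R) (omega : R -> R) d k (A : set 'rV[R]_d)
    (f : 'rV[R]_d -> 'rV[R]_k) :=
  exists2 K : R, 0 < K & forall x y, A x -> A y ->
    0 < norm2 (y - x) < a -> norm2 (f y - f x) <= K * omega (norm2 (y - x)).

Definition bi_omega_mapping (a : R) (omega : R -> R) d k (A : set 'rV[R]_d)
    (f : 'rV[R]_d -> 'rV[R]_k) :=
  [/\ set_inj A f, omega_mapping a omega A f &
      omega_mapping a omega (f @` A) ('pinv_(fun=> 0) A f)].

(* the measure on A with density rho, as a set function on the whole space *)
Definition density_measure d (A : set 'rV[R]_d) (rho : 'rV[R]_d -> R)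
    (S : set 'rV[R]_d) : \bar R :=
  (\int[@lebesgue_rV R d]_(x in A `&` S) (rho x)%:E)%E.

(* S ranges over Borel sets. Since density_measure ignores the complement of
   the cube, f @^-1` S stands for the preimage of S under the restriction of f
   to the cube. *)
Definition pushforward_equation d (rho : 'rV[R]_d -> R)
    (f : 'rV[R]_d -> 'rV[R]_d) :=
  forall S : set 'rV[R]_d, measurable S ->
    pushforward (density_measure (unit_cube d) rho) f S =
    lebesgue_rV (S `&` f @` unit_cube d).

End bi_omega.
Arguments unit_cube {R} d _.

(* Main.v *)
(* The argument of Burago and Kleiner, run over infinitely many scales. The density depends on
   (x1, x2) only. At stage j it oscillates in x1 with amplitude c_j -> 0 at scale l_(j+1), inside
   thin stripes in x2 which are nested in the stripes of the previous stages. Suppose that f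
   realizes it and has bi-Lipschitz constant at most b at the scales of stage j, and that a
   segment of length l_j in direction e1 is stretched by the factor A. If no subsegment of length
   l_(j+1) nearby were stretched by (1 + b^-m) A, then f would nearly be a translation
   between two adjacent cells; as f(cube) contains balls of controlled radius around images of
   interior points (quantitative invariance of domain), a translate of the image of one cell,
   slightly shrunk, lies in the image of the next one, contradicting that the first
   cell has larger mass. So the stretch grows by 1 + b^-m at each stage. For the modulus
   t log(1/t)^alpha the constant at stage j is of order (j log j)^alpha, and for small
   alpha the growth of the stretch wins. *)

Require Import Defs.
From mathcomp Require Import all_boot all_order all_algebra.
From mathcomp Require Import all_classical all_reals all_analysis.
From mathcomp Require Import measurable_realfun ring lra zify.
Import Order.TTheory GRing.Theory Num.Theory.
Import numFieldNormedType.Exports.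
Local Open Scope classical_set_scope.
Local Open Scope ring_scope.
Set Implicit Arguments.
Unset Strict Implicit.
Unset Printing Implicit Defensive.


(** * Cubical cochains modulo 2 *)

(** The modulus gives no derivative, only [|f x - f y| <= L * (|x - y| + h)] at small distances, for
    every small [h], with [L] of order [ln (1 / h)] to the power [alpha], and likewise for the
    inverse. Every argument therefore has to tolerate the error [h]: increments are compared at the
    nodes of a grid of mesh [h], at all nodes of a cell simultaneously, and the passage from nodes
    to whole cells is topological, resting in the end on a count of cubes modulo 2. The density must
    not depend on [f], so the constant [K] of [f] is unknown when it is built. It contains, for each
    [b = 2 ^ T], a block of stages of amplitude [1 / b], and the contradiction is reached inside a
    single block, chosen after [K]. A stage divides the cell by [b ^ m] with [m = 6 * d + 14], and
    about [b ^ (m + 2)] stages are used; their meshes satisfy [ln (1 / h) <= C * b ^ (m + 3)]. The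
    exponent [alpha = 1 / (2 * (m + 3))] makes [L] of order [sqrt b], which is below [b] once [b] is
    large compared with [K]. *)

Section cubical_cochains.
Variable d : nat.
Let grid := 'I_d -> nat.
Implicit Types (a b F G : grid -> bool) (z w : grid) (J : {set 'I_d}).

Definition upd z (j : 'I_d) t : grid := fun i => if i == j then t else z i.
Definition next j z := upd z j (z j).+1.
Definition diff j a z : bool := a (next j z) + a z.

(** Coefficient of [dx_J] in the product [da_1 ... da_k] of coboundaries modulo 2, with [+] on
    [bool] as exclusive or. For [s] as long as [J], it sums over the monotone lattice paths from [z]
    to the opposite vertex of the cube spanned by [J] the product of the increments of [a_i] along
    the [i]-th edge. *)
Fixpoint cup J (s : seq (grid -> bool)) z : bool :=
  if s is a :: s' then \sum_(j in J) diff j a z * cup (J :\ j) s' (next j z)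
  else 1.

Lemma updE z j t : upd z j t j = t. Proof. by rewrite /upd eqxx. Qed.

Lemma upd_neq z i j t : i != j -> upd z j t i = z i.
Proof. by rewrite /upd => /negbTE ->. Qed.

Lemma updC z i j s t : i != j -> upd (upd z i s) j t = upd (upd z j t) i s.
Proof.
move=> ij; apply/funext => k; rewrite /upd.
by case: eqP => // ->; case: eqP => // e; rewrite -e eqxx in ij.
Qed.

Lemma updK z j s t : upd (upd z j s) j t = upd z j t.
Proof. by apply/funext => k; rewrite /upd; case: eqP. Qed.

Lemma nextC i j z : next i (next j z) = next j (next i z).
Proof.
have [->//|ij] := eqVneq i j.
by rewrite /next !upd_neq// 1?eq_sym// updC// eq_sym.
Qed.

Lemma addbb2 (x : bool) : x + x = 0. Proof. by case: x. Qed.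

Lemma neq0b (x : bool) : (x != 0) = x. Proof. by case: x. Qed.

Lemma diffC i j a z : diff i (diff j a) z = diff j (diff i a) z.
Proof. by rewrite /diff nextC -!addrA; congr (_ + _); rewrite addrCA. Qed.

Lemma diffM j a b z :
  diff j (fun z => a z * b z) z = diff j a z * b (next j z) + a z * diff j b z.
Proof.
rewrite /diff mulrDl mulrDr -!addrA; congr (_ + _).
by rewrite addrA addbb2 add0r.
Qed.

Lemma diff_sum j (I : finType) (P : pred I) (F : I -> grid -> bool) z :
  diff j (fun z => \sum_(i | P i) F i z) z = \sum_(i | P i) diff j (F i) z.
Proof. by rewrite /diff big_split. Qed.

(** Each unordered pair is counted twice. *)
Lemma sum_sym2 J (S : 'I_d -> 'I_d -> bool) : (forall i j, S i j = S j i) ->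
  \sum_(j in J) \sum_(i in J :\ j) S i j = 0.
Proof.
move=> symS.
under eq_bigr => j _.
  rewrite (bigID (fun i : 'I_d => (i < j)%N)) /=.
  over.
rewrite big_split /=.
rewrite [X in _ + X](exchange_big_dep (mem J)) /=; last first.
  by move=> i j _ /andP[/setD1P[]].
rewrite -[RHS](addbb2 (\sum_(j in J) \sum_(i in J :\ j | (i < j)%N) S i j)).
congr (_ + _); apply: eq_bigr => i iJ; apply: eq_big => [j|j _]; last exact: symS.
by rewrite !inE iJ -leqNgt ltn_neqAle; case: (j \in J); rewrite ?andbT ?andbF //=
  eq_sym andbA andbb.
Qed.

(* d o d = 0 for the twisted calculus [dx_j a = (a o next j) dx_j]. *)
Lemma cup_closed s J z :
  \sum_(j in J) diff j (fun z => cup (J :\ j) s z) z = 0.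
Proof.
elim: s J z => [|a s IH] J z /=.
  by rewrite big1// => j _; rewrite /diff addbb2.
under eq_bigr => j _.
  rewrite diff_sum.
  under eq_bigr => i _ do rewrite diffM.
  rewrite big_split/=; over.
(* The second differences cancel by symmetry; what remains is the induction hypothesis at
   [next i z]. *)
rewrite big_split/= sum_sym2 ?add0r; last first.
  by move=> i j; rewrite diffC nextC 2!finset.setDDl (finset.setUC [set i]).
rewrite (exchange_big_dep (mem J)) /=; last by move=> i j _ /setD1P[].
rewrite big1// => i iJ.
rewrite -big_distrr/=; apply/eqP; rewrite mulf_eq0; apply/orP; right; apply/eqP.
rewrite -[RHS](IH (J :\ i) (next i z)); apply: eq_big => [j|j /andP[jJ _]].
  by rewrite !inE iJ andbT eq_sym andbC.
by rewrite /diff nextC 2!finset.setDDl (finset.setUC [set i]).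
Qed.

(** The cube spanned by [J] at [z] lies in the hyperplane where coordinate [j] equals [w0], so all
    increments of [a] along its edges vanish. *)
Lemma cup_const s J j a (w0 : nat) z : a \in s -> j \notin J ->
  (forall w w', w j = w0 -> w' j = w0 -> a w = a w') ->
  z j = w0 -> cup J s z = 0.
Proof.
elim: s J z => //= b s IH J z + jJ ac zj; rewrite inE => /predU1P[<-|as_].
  rewrite big1// => i iJ; have ij : i != j by apply: contraNneq jJ => <-.
  rewrite /diff (ac (next i z) z) ?addbb2 ?mul0r//.
  by rewrite /next upd_neq// eq_sym.
rewrite big1// => i iJ; have ij : i != j by apply: contraNneq jJ => <-.
rewrite IH ?mulr0//; first by rewrite !inE (negbTE jJ) andbF.
by rewrite /next upd_neq// eq_sym.
Qed.

(** Some path contributes a nonzero product, and one edge of this path carries an increment of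
    [a]. *)
Lemma cup_neq0 s J z a : a \in s -> cup J s z ->
  exists w w', [/\ forall i, (z i <= w i <= (z i).+1)%N,
    forall i, (z i <= w' i <= (z i).+1)%N & a w != a w'].
Proof.
suff: cup J s z -> a \in s -> exists w w',
   [/\ forall i, (z i <= w i <= z i + (i \in J))%N,
     forall i, (z i <= w' i <= z i + (i \in J))%N & a w != a w'].
  move=> h /[swap] /h{}h /h[w [w' [h1 h2 h3]]]; exists w, w'; split => // i.
    have /andP[-> /leq_trans->]// := h1 i.
    by case: (i \in J); rewrite ?addn1 ?addn0.
  have /andP[-> /leq_trans->]// := h2 i.
  by case: (i \in J); rewrite ?addn1 ?addn0.
elim: s J z => //= b s IH J z.
move=> h; have {h}sum0 := etrans (neq0b _) h.
have [j jJ] : exists2 j, j \in J & diff j b z * cup (J :\ j) s (next j z) != 0.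
  apply/exists_inP; apply: contraNT sum0 => /exists_inPn h.
  by rewrite big1// => j /h /negPn/eqP.
rewrite mulf_eq0 negb_or => /andP[db cups].
rewrite inE => /predU1P[->|as_].
  exists (next j z), z; split.
  - move=> i; rewrite /next /upd; case: eqP => [->|_]; last by rewrite leqnn leq_addr.
    by rewrite jJ addn1 leqnn leqnSn.
  - by move=> i; rewrite leqnn leq_addr.
  - by move: db; rewrite /diff; case: (b _); case: (b _).
have [w [w' [h1 h2 h3]]] := IH (J :\ j) (next j z) (etrans (esym (neq0b _)) cups) as_.
have sub x : (forall i, (next j z i <= x i <= next j z i + (i \in J :\ j))%N) ->
    forall i, (z i <= x i <= z i + (i \in J))%N.
  move=> h i; have := h i; rewrite /next /upd !inE; case: eqP => [->|_] //=.
  by rewrite addn0 jJ addn1 => /andP[/ltnW -> ->].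
by exists w, w'; split => //; exact: sub.
Qed.

Variable n : nat.

Fixpoint box_sum (s : seq 'I_d) F z : bool :=
  if s is j :: s' then \sum_(t < n) box_sum s' F (upd z j t) else F z.

Lemma eq_box_sum s F G z : F =1 G -> box_sum s F z = box_sum s G z.
Proof.
by move=> FG; elim: s z => //= j s IH z; apply: eq_bigr => t _; exact: IH.
Qed.

Lemma box_sumD s F G z :
  box_sum s (fun z => F z + G z) z = box_sum s F z + box_sum s G z.
Proof.
elim: s z => //= j s IH z; rewrite -big_split/=.
by apply: eq_bigr => t _; exact: IH.
Qed.

Lemma box_sum_sum s (I : finType) (P : pred I) (F : I -> grid -> bool) z :
  box_sum s (fun z => \sum_(i | P i) F i z) z = \sum_(i | P i) box_sum s (F i) z.
Proof.
elim: s z => //= j s IH z; rewrite exchange_big/=.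
by apply: eq_bigr => t _; exact: IH.
Qed.

Lemma box_sum_neq0 s F z : box_sum s F z ->
  exists w, [/\ F w, forall j, j \in s -> (w j < n)%N &
    forall j, j \notin s -> w j = z j].
Proof.
elim: s z => [|j s IH] z /=; first by exists z; split.
move=> h; have {h}sum0 := etrans (neq0b _) h.
have [t] : exists t : 'I_n, box_sum s F (upd z j t) != 0.
  apply/existsP; apply: contraNT sum0 => /existsPn h.
  by rewrite big1// => t _; move: (h t) => /negPn/eqP.
rewrite neq0b => /IH[w [Fw ws wz]]; exists w; split => // i.
  rewrite inE => /predU1P[->|/ws//]; have [/ws//|/wz ->] := boolP (j \in s).
  by rewrite updE.
by rewrite inE negb_or => /andP[ij /wz ->]; rewrite upd_neq.
Qed.

Lemma box_sum_next s j F z : j \notin s ->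
  box_sum s (fun z => F (next j z)) z = box_sum s F (next j z).
Proof.
elim: s z => //= i s IH z; rewrite inE negb_or => /andP[ji js].
apply: eq_bigr => t _; rewrite IH//; congr box_sum.
by rewrite /next upd_neq// updC// eq_sym.
Qed.

Lemma box_sum_eq0 s F j z : j \notin s ->
  (forall w, w j = z j -> F w = 0) -> box_sum s F z = 0.
Proof.
elim: s z => [|i s IH] z /=; first by move=> _; exact.
rewrite inE negb_or => /andP[ji js] h; rewrite big1// => t _.
by rewrite IH// => w; rewrite upd_neq//; exact: h.
Qed.

(** Stokes modulo 2: the sum telescopes in direction [j] to the values of [F] on the faces [0] and
    [n]. *)
Lemma box_sum_diff s j F z : uniq s -> j \in s ->
  (forall w, w j = 0%N -> F w = 0) -> (forall w, w j = n -> F w = 0) ->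
  box_sum s (diff j F) z = 0.
Proof.
move=> + + F0 Fn; elim: s z => //= i s IH z /andP[ni us].
rewrite inE => /predU1P[ji|js]; last by rewrite big1// => t _; exact: IH.
subst i.
have E t : box_sum s (diff j F) (upd z j t) =
    box_sum s F (upd z j t.+1) + box_sum s F (upd z j t).
  by rewrite box_sumD box_sum_next// /next updE updK.
under eq_bigr do rewrite E.
have -> m : \sum_(i < m) (box_sum s F (upd z j i.+1) + box_sum s F (upd z j i)) =
    box_sum s F (upd z j m) + box_sum s F (upd z j 0).
  elim: m => [|m IHm]; first by rewrite big_ord0 addbb2.
  rewrite big_ord_recr/= IHm addrC -!addrA; congr (_ + _).
  by rewrite addrA addbb2 add0r.
rewrite (@box_sum_eq0 _ _ j)//; last by move=> w; rewrite updE; exact: Fn.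
by rewrite (@box_sum_eq0 _ _ j)// => w; rewrite updE; exact: F0.
Qed.

Hypothesis n_gt0 : (0 < n)%N.
Variable a : 'I_d -> grid -> bool.
Hypothesis a0 : forall i w, w i = 0%N -> a i w = 0.
Hypothesis an : forall i w, w i = n -> a i w = 1.

(* Replacing the first factor by the step function [w i > 0], which has the same
   boundary values, does not change the sum, and leaves the cup product of the
   remaining factors on a slice. *)
Lemma box_sum_cup s z : uniq s -> box_sum s (cup [set i in s] (map a s)) z = 1.
Proof.
elim: s z => //= i s IH z /andP[is_ us].
set J := [set j in i :: s].
pose e (w : grid) : bool := (0 < w i)%N.
pose b w := a i w + e w.
have JD : J :\ i = [set j in s].
  by apply/setP => j; rewrite !inE; case: eqP => //= ->; rewrite (negbTE is_).
have aE w : a i w = b w + e w by rewrite /b -addrA addbb2 addr0.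
(* By closedness of the cup product the summand is the sum over [j] of the differences of [b * cup],
   and Stokes applies in each direction: for [j = i] the function [b] vanishes on both faces, for
   [j \in s] the factor [a j] is constant on each face. *)
have key : box_sum (i :: s) (fun w =>
    \sum_(j in J) diff j b w * cup (J :\ j) (map a s) (next j w)) z = 0.
  rewrite (@eq_box_sum _ _ (fun w =>
      \sum_(j in J) diff j (fun w => b w * cup (J :\ j) (map a s) w) w)); last first.
    move=> w; under [RHS]eq_bigr => j _ do rewrite diffM.
    by rewrite [RHS]big_split/= -[X in _ + X]big_distrr/= cup_closed mulr0 addr0.
  rewrite box_sum_sum big1// => j; rewrite inE => jJ.
  have vanish m w : (m = 0 \/ m = n)%N -> w j = m ->
      b w * cup (J :\ j) (map a s) w = 0.
    move=> mP wj; case/predU1P: jJ => [ji|js].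
      subst j; rewrite /b /e; case: mP => m0; rewrite m0 in wj.
        by rewrite a0// wj mul0r.
      by rewrite an// wj n_gt0 mul0r.
    rewrite (@cup_const _ _ j (a j) m) ?mulr0//; first exact: map_f.
      by rewrite !inE eqxx.
    by case: mP => -> x y xj yj; [rewrite !a0 | rewrite !an].
  apply: box_sum_diff => //=; first by rewrite is_.
    by move=> w; apply: vanish; left.
  by move=> w; apply: vanish; right.
transitivity (box_sum (i :: s) (fun w =>
    \sum_(j in J) diff j e w * cup (J :\ j) (map a s) (next j w)) z).
  rewrite -[RHS]add0r -[X in X + _]key -box_sumD.
  rewrite -[LHS]/(box_sum (i :: s) _ z); apply: eq_box_sum => w.
  rewrite -big_split/=; apply: eq_bigr => j _.
  by rewrite -mulrDl; congr (_ * _); rewrite /diff !aE addrACA.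
rewrite (@eq_box_sum _ _ (fun w => diff i e w * cup (J :\ i) (map a s) (next i w)));
  last first.
  move=> w; rewrite (bigD1 i)/= ?inE ?eqxx// big1 ?addr0// => j /andP[_ ji].
  by rewrite /diff /e /next upd_neq 1?eq_sym// addbb2 mul0r.
(* Only the slice [w i = 0] sees a nonzero [diff i e]; the other factors are then read at height
   [1], where the induction hypothesis applies. *)
rewrite JD /=; case: n n_gt0 (IH) => // n' _ {}IH.
rewrite big_ord_recl big1 ?addr0 => [|t _]; last first.
  rewrite (@box_sum_eq0 _ _ i)// => w; rewrite updE => wi.
  by rewrite /diff /e /next updE wi mul0r.
rewrite /= -[RHS](IH (upd z i 1) us).
have : forall y, y i = 0%N ->
  box_sum s (fun w => diff i e w * cup [set j in s] (map a s) (next i w)) y =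
  box_sum s (fun w => cup [set j in s] (map a s) (next i w)) y.
  move=> y yi; apply/eqP; rewrite -subr_eq0; apply/eqP.
  rewrite -[- _]/(_) -box_sumD (@box_sum_eq0 _ _ i)// => w; rewrite yi => wi.
  by rewrite /diff /e /next updE wi /= mul1r addbb2.
move=> ->; last by rewrite updE.
by rewrite box_sum_next// /next updE updK.
Qed.

End cubical_cochains.

(** The product of the coboundaries sums to [1] over the grid, hence is nonzero on some cube, and
    there no factor is constant. *)
Lemma grid_miranda d n (a : 'I_d -> ('I_d -> nat) -> bool) : (0 < n)%N ->
  (forall i w, w i = 0%N -> a i w = false) -> (forall i w, w i = n -> a i w) ->
  exists z : 'I_d -> nat, (forall i, (z i < n)%N) /\
    forall i, exists w w', [/\ forall k, (z k <= w k <= (z k).+1)%N,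
      forall k, (z k <= w' k <= (z k).+1)%N, a i w = false & a i w'].
Proof.
move=> n0 a0 an; have := box_sum_cup n0 a0 an (fun=> 0%N) (enum_uniq 'I_d).
move=> /idP/box_sum_neq0[z [cz zn _]]; exists z; split.
  by move=> i; rewrite zn// mem_enum.
move=> i; have [|w [w' [h1 h2]]] := cup_neq0 _ cz (a := a i).
  by apply: map_f; rewrite mem_enum.
case aw : (a i w); case aw' : (a i w') => // _; last by exists w, w'.
by exists w', w.
Qed.

(** * The Poincare-Miranda theorem *)

Section sup_norm.
Variables (R : realType) (d : nat).
Implicit Types (v x p : 'rV[R]_d) (r t : R).

Lemma coord_le_norm v i : `|v 0 i| <= `|v|.
Proof.
rewrite [leRHS]/Num.norm/= mx_normrE.
exact: (le_bigmax _ (fun ij : 'I_1 * 'I_d => `|v ij.1 ij.2|) (0, i)).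
Qed.

Lemma norm_rV_le v t : 0 <= t -> (forall i, `|v 0 i| <= t) -> `|v| <= t.
Proof.
move=> t0 vt; rewrite [leLHS]/Num.norm/= mx_normrE; apply/bigmax_leP; split => //.
by move=> [i j] _ /=; rewrite ord1.
Qed.

Definition cube p r : set 'rV[R]_d := [set v | forall i, p 0 i <= v 0 i <= p 0 i + r].

Lemma cube_compact p r : compact (cube p r).
Proof.
have -> : cube p r = [set v : 'rV[R]_d | forall i, `[p 0 i, p 0 i + r]%classic (v ord0 i)].
  by apply/seteqP; split => v /= h i; have := h i; rewrite in_itv.
by apply: (rV_compact (A := fun i => `[p 0 i, p 0 i + r]%classic)) => i; exact: segment_compact.
Qed.

Lemma cube_dist p r x y : 0 <= r -> cube p r x -> cube p r y -> `|x - y| <= r.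
Proof.
move=> r0 xp yp; apply: norm_rV_le => // i.
by have := xp i; have := yp i; rewrite !mxE ler_norml; lra.
Qed.

End sup_norm.

(** Cubes of mesh tending to zero, on which every coordinate of [F] takes a value [<= 0] and a value
    [>= 0], accumulate at a zero. *)
Lemma poincare_miranda (R : realType) d (p : 'rV[R]_d) r (F : 'rV[R]_d -> 'rV[R]_d) :
  0 < r -> (forall x, cube p r x -> {for x, continuous F}) ->
  (forall x i, cube p r x -> x 0 i = p 0 i -> F x 0 i <= 0) ->
  (forall x i, cube p r x -> x 0 i = p 0 i + r -> 0 <= F x 0 i) ->
  exists2 x, cube p r x & F x = 0.
Proof.
move=> r0 Fc Fle Fge.
pose pt n (w : 'I_d -> nat) : 'rV[R]_d := \row_i (p 0 i + r * (w i)%:R / n.+1%:R).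
have n1 n : 0 < n.+1%:R :> R by rewrite ltr0n.
have ptS n w : (forall i, (w i <= n.+1)%N) -> cube p r (pt n w).
  move=> wn i; rewrite mxE lerDl lerD2l ler_pdivrMr// ler_pM2l// ler_nat wn andbT.
  by rewrite divr_ge0// ?ler0n// mulr_ge0// ?ler0n// ltW.
(* On the faces the value is prescribed: [F] may vanish on an upper face, where the test [0 < F]
   would fail. *)
pose a n i (w : 'I_d -> nat) : bool :=
  if w i == 0%N then false else if (n.+1 <= w i)%N then true else 0 < F (pt n w) 0 i.
have aF n i w : (forall i, (w i <= n.+1)%N) -> a n i w = false -> F (pt n w) 0 i <= 0.
  move=> wn; rewrite /a; case: eqP => [w0 _|_].
    by apply: Fle; [exact: ptS|rewrite mxE w0 mulr0 mul0r addr0].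
  by case: ifP => // _ /negbT; rewrite -leNgt.
have aT n i w : (forall i, (w i <= n.+1)%N) -> a n i w -> 0 <= F (pt n w) 0 i.
  move=> wn; rewrite /a; case: eqP => // _; case: ifP => [nw _|_ /ltW//].
  apply: Fge; first exact: ptS.
  have -> : p 0 i + r = p 0 i + r * n.+1%:R / n.+1%:R by rewrite mulfK// gt_eqF.
  by rewrite mxE; do 4 f_equal; apply/eqP; rewrite eqn_leq wn nw.
have /choice[z zP] : forall n, exists z : 'I_d -> nat, (forall i, (z i < n.+1)%N) /\
    forall i, exists w w', [/\ forall k, (z k <= w k <= (z k).+1)%N,
      forall k, (z k <= w' k <= (z k).+1)%N, a n i w = false & a n i w'].
  move=> n; apply: grid_miranda => //.
    by move=> i w wi; rewrite /a wi eqxx.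
  by move=> i w wi; rewrite /a wi leqnn.
pose x n := pt n (z n).
have xS n : cube p r (x n) by apply: ptS => i; apply: ltnW; have [] := zP n.
have xw n w : (forall k, (z n k <= w k <= (z n k).+1)%N) -> `|pt n w - x n| <= r / n.+1%:R.
  move=> zw; apply: norm_rV_le => [|i]; first by rewrite divr_ge0// ltW.
  rewrite !mxE opprD addrACA subrr add0r -mulrBl -mulrBr normrM normrM.
  have inv0 : 0 < n.+1%:R^-1 :> R by rewrite invr_gt0.
  rewrite (gtr0_norm r0) (gtr0_norm inv0) ler_pM2r//.
  rewrite -[leRHS]mulr1 ler_pM2l//.
  have /andP[zw1 zw2] := zw i.
  rewrite -natrB// ger0_norm ?ler0n// (_ : 1 = 1%:R)// ler_nat.
  by rewrite leq_subLR addn1.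
have [xs xsS xsC] : exists2 xs, cube p r xs & cluster (x @ \oo) xs.
  have [|xs [? ?]] := @cube_compact R d p r (x @ \oo) _; last by exists xs.
  by exists 0%N => // n _; exact: xS.
exists xs => //; apply/rowP => i; rewrite [RHS]mxE; apply/eqP; rewrite eq_le.
have near_xs (P : set 'rV[R]_d) : nbhs xs P ->
    exists n, forall w, (forall k, (z n k <= w k <= (z n k).+1)%N) -> P (pt n w).
  move=> /nbhs_ballP[e /= e0 eP].
  have e20 : 0 < e / 2 / r by rewrite !divr_gt0.
  have [N _ NP] := near_infty_natSinv_lt (PosNum e20).
  have [||_ [[n nN <-] xn]] := xsC [set x n | n in [set n | (N <= n)%N]] (ball xs (e / 2)).
  - exists N => // n /= Nn; by exists n.
  - by apply: nbhsx_ballx; rewrite divr_gt0.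
  exists n => w zw; apply: eP; rewrite -ball_normE /= in xn *.
  rewrite -(subrKA (x n)) (le_lt_trans (ler_normD _ _))//.
  rewrite [ltRHS]splitr ltrD// distrC (le_lt_trans (xw _ _ zw))//.
  have := NP n nN; rewrite /= ltr_pdivlMr// => h.
  by rewrite mulrC.
have cFi : {for xs, continuous (fun y => F y 0 i)}.
  apply: (@continuous_comp _ _ _ F (fun v : 'rV[R]_d => v 0 i)); first exact: Fc.
  exact: coord_continuous.
have wS n w : (forall k, (z n k <= w k <= (z n k).+1)%N) -> forall k, (w k <= n.+1)%N.
  move=> zw k; have /andP[_ /leq_trans] := zw k; apply.
  by have [/(_ k)] := zP n.
apply/andP; split; rewrite leNgt; apply/negP => Fi.
  have [n nP] := near_xs _ (cvgr_gt _ cFi _ Fi).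
  have [_ /(_ i)[w [_ [zw _ aw _]]]] := zP n.
  by have := nP w zw; rewrite ltNge (aF _ _ _ (wS _ _ zw) aw).
have [n nP] := near_xs _ (cvgr_lt _ cFi _ Fi).
have [_ /(_ i)[_ [w [_ zw _ aw]]]] := zP n.
by have := nP w zw; rewrite ltNge (aT _ _ _ (wS _ _ zw) aw).
Qed.

(** * Quantitative invariance of domain *)

(* Pigeonhole: m^d points of a grid of x0 + [0, v0]^d would have preimages on the
   sphere at mutual distance >= c/m, but the sphere only has room for O(m^(d-1)). *)
Lemma lipschitz_sphere_avoid (R : realType) d (G : 'rV[R]_d -> 'rV[R]_d) L e v0
    (c x0 : 'rV[R]_d) : (0 < d)%N -> 0 < L -> 0 < e -> 0 < v0 ->
  (forall y y', `|G y - G y'| <= L * `|y - y'|) ->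
  exists2 v, `|v| <= v0 & forall y, `|y - c| = e -> G y != x0 + v.
Proof.
case: d G c x0 => // d G c x0 _ L0 e0 v00 GL; apply: contrapT => noex.
have hit v : `|v| <= v0 -> exists y, `|y - c| = e /\ G y = x0 + v.
  move=> vv0; apply: contrapT => noy; apply: noex; exists v => // y ye.
  by apply/eqP => Gy; apply: noy; exists y.
(* In sup norm the sphere has [2 * d.+1] faces (the dimension is now [d.+1]), each covered by
   [(C0 * m + 1) ^ d] cells of side [s], because [2 * e / s <= C0 * m]. As
   [C0 * m + 1 <= C0.+1 * m], the choice of [m] makes the [m ^ d.+1] grid points more numerous. The
   side [s] keeps the images of two points of one cell within [v0 / (2 * m)], half of the grid
   step. *)
pose C0 := (Num.trunc (4 * e * L / v0)).+1.
have C0P : 4 * e * L / v0 <= C0%:R by apply/ltW/truncnS_gt.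
pose m := (d.+1 * 2 * C0.+1 ^ d).+1.
have m0 : 0 < m%:R :> R by rewrite ltr0n.
have [s sE] : exists s, s = v0 / (2 * m%:R * L) by exists (v0 / (2 * m%:R * L)).
have s0 : 0 < s by rewrite sE divr_gt0// !mulr_gt0.
have /choice[y yP] : forall k : {ffun 'I_d.+1 -> 'I_m}, exists y : 'rV[R]_d.+1,
    `|y - c| = e /\ G y = x0 + \row_i (v0 * (k i)%:R / m%:R).
  move=> k; apply: hit; apply: norm_rV_le => [|i]; first exact: ltW.
  rewrite mxE ger0_norm; last by rewrite divr_ge0 ?mulr_ge0 ?ler0n// ltW.
  by rewrite ler_pdivrMr// ler_pM2l// ler_nat ltnW.
have /choice[f fP] : forall k, exists i, `|(y k - c) 0 i| = e.
  move=> k; have [ye _] := yP k; apply: contrapT => nof.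
  have lt_e i : `|(y k - c) 0 i| < e.
    rewrite lt_neqAle -{2}ye coord_le_norm andbT.
    by apply/eqP => ?; apply: nof; exists i.
  have : `|y k - c| < e.
    rewrite [ltLHS]/Num.norm/= mx_normrE; apply/bigmax_ltP; split => //.
    by move=> [i j] _ /=; rewrite ord1.
  by rewrite ye ltxx.
pose cell k j : nat := Num.trunc ((y k 0 j - c 0 j + e) / s).
have ye0 k j : 0 <= (y k 0 j - c 0 j + e) / s.
  rewrite divr_ge0 ?(ltW s0)//.
  have := coord_le_norm (y k - c) j; rewrite (yP k).1 !mxE ler_norml; lra.
have cell_le k j : (cell k j < (C0 * m).+1)%N.
  rewrite ltnS /cell truncn_le_nat (@le_lt_trans _ _ (C0 * m)%:R) ?ltr_nat//.
  rewrite ler_pdivrMr// natrM.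
  have h : 4 * e * L <= C0%:R * v0 by rewrite -ler_pdivrMr.
  have -> : C0%:R * m%:R * s = C0%:R * v0 / (2 * L).
    by rewrite sE; field; rewrite !gt_eqF.
  rewrite ler_pdivlMr ?mulr_gt0//.
  have := coord_le_norm (y k - c) j; rewrite (yP k).1 !mxE ler_norml => /andP[_ h2].
  apply: le_trans h; rewrite mulrA (_ : 4 * e = e * 2 * 2) ?ler_pM2r//; [lra|ring].
pose phi (k : {ffun 'I_d.+1 -> 'I_m}) : 'I_d.+1 * bool * {ffun 'I_d -> 'I_(C0 * m).+1} :=
  (f k, 0 < (y k - c) 0 (f k), [ffun j => Ordinal (cell_le k (lift (f k) j))]).
have /leq_card : injective phi.
  move=> k k' [ff fs /ffunP fc].
  have ys : `|y k - y k'| <= s.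
    apply: norm_rV_le => [|j]; first exact: ltW.
    have [->|jf] := eqVneq j (f k).
      suff yy : y k 0 (f k) = y k' 0 (f k) by rewrite !mxE yy subrr normr0 ltW.
      have := fP k; have := fP k'; rewrite -ff; move: fs; rewrite -ff !mxE.
      case: ltP => [h1|h1]; case: ltP => // h2 _.
        by rewrite (gtr0_norm h1) (gtr0_norm h2); lra.
      by rewrite (ler0_norm h1) (ler0_norm h2); lra.
    case: (unliftP (f k) j) jf => [j' ->|->]; last by rewrite eqxx.
    move=> _; set j1 := lift _ _.
    have ce : cell k j1 = cell k' j1.
      by have := fc j'; rewrite !ffunE -ff => -[].
    have := truncn_itv (ye0 k j1); have := truncn_itv (ye0 k' j1).
    rewrite -/(cell k j1) -/(cell k' j1) ce.
    rewrite !ler_pdivlMr// !ltr_pdivrMr// !mxE -!(natr1 (cell _ _)) ler_norml mulrDl mul1r.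
    lra.
  apply/ffunP => i; apply/val_inj => /=.
  have := le_trans (coord_le_norm _ i) (le_trans (GL (y k) (y k')) (ler_wpM2l (ltW L0) ys)).
  rewrite (yP k).2 (yP k').2 opprD addrACA subrr add0r !mxE.
  have -> : L * s = v0 / m%:R * 2^-1.
    by rewrite sE; field; rewrite !gt_eqF.
  have -> : v0 * (k i)%:R / m%:R - v0 * (k' i)%:R / m%:R =
    v0 / m%:R * ((k i)%:R - (k' i)%:R) by field; rewrite gt_eqF.
  rewrite normrM gtr0_norm ?divr_gt0// ler_pM2l ?divr_gt0// => h.
  apply/eqP; rewrite eqn_leq -[X in X && _]ltnS -[X in _ && X]ltnS -!(ltr_nat R).
  rewrite -(natr1 (k i)) -(natr1 (k' i)).
  by move: h; rewrite ler_norml => /andP[h1 h2]; apply/andP; split; lra.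
rewrite !card_prod !card_ffun !card_ord card_bool.
apply/negP; rewrite -ltnNge.
have le1 : ((C0 * m).+1 <= C0.+1 * m)%N by rewrite mulSn -addn1 addnC leq_add2r.
apply: (@leq_ltn_trans (d.+1 * 2 * (C0.+1 * m) ^ d)).
  by rewrite leq_mul2l; case: (d) => // n; rewrite leq_exp2r// le1 orbT.
by rewrite expnMn mulnA expnS ltn_mul2r expn_gt0 /= ltnS.
Qed.

Section coarse_inverse.
Variables (R : realType) (d : nat) (S : set 'rV[R]_d) (p : 'rV[R]_d) (L h : R).
Variable g : 'rV[R]_d -> 'rV[R]_d.
Hypotheses (S0 : S !=set0) (Sp : forall x i, S x -> p 0 i <= x 0 i) (L0 : 0 < L).
Hypothesis g2 : forall x x', S x -> S x' -> `|x - x'| <= L * (`|g x - g x'| + h).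

(* McShane extension of a map that is Lipschitz at scales >= h only *)
Definition coarse_inv (y : 'rV[R]_d) : 'rV[R]_d :=
  \row_i inf [set x 0 i + L * `|y - g x| | x in S].

Let E y i := [set x 0 i + L * `|y - g x| | x in S].

Let E_lb y i : has_lbound (E y i).
Proof.
exists (p 0 i) => _ [x Sx <-]; rewrite -[leLHS]addr0 lerD ?Sp//.
by rewrite mulr_ge0// ltW.
Qed.

Let E_nonempty y i : E y i !=set0.
Proof. by have [x Sx] := S0; exists (x 0 i + L * `|y - g x|); exists x. Qed.

Lemma coarse_inv_lipschitz y y' : `|coarse_inv y - coarse_inv y'| <= L * `|y - y'|.
Proof.
apply: norm_rV_le => [|i]; first by rewrite mulr_ge0// ltW.
have half z z' : coarse_inv z 0 i - L * `|z - z'| <= coarse_inv z' 0 i.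
  rewrite !mxE; apply: lb_le_inf; first exact: E_nonempty.
  move=> _ [x Sx <-]; rewrite lerBlDr -addrA -mulrDr.
  apply: (@le_trans _ _ (x 0 i + L * `|z - g x|)).
    by apply: ge_inf; [exact: E_lb|exists x].
  rewrite lerD2l ler_pM2l// -(subrKA z') (le_trans (ler_normD _ _))//.
  by rewrite addrC.
have := half y y'; have := half y' y; rewrite distrC ler_norml !mxE; lra.
Qed.

Lemma coarse_invK x : S x -> `|coarse_inv (g x) - x| <= L * h.
Proof.
move=> Sx.
have Lh : 0 <= L * h by have := g2 Sx Sx; rewrite !subrr !normr0 add0r.
apply: norm_rV_le => // i; rewrite !mxE ler_norml; apply/andP; split; last first.
  rewrite lerBlDr (le_trans (ge_inf (E_lb _ _) (x := x 0 i) _)) ?lerDr//.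
  by exists x => //; rewrite subrr normr0 mulr0 addr0.
rewrite lerBrDr; apply: lb_le_inf; first exact: E_nonempty.
move=> _ [x' Sx' <-]; have := g2 Sx Sx'; have := coord_le_norm (x - x') i.
by rewrite mulrDr !mxE ler_norml; lra.
Qed.

End coarse_inverse.

(* If c is not attained, push g radially out of the ball of radius e around c and apply the
   coarse inverse: this is close to the identity on the cube, hence attains x0 + v for
   every small v by Poincare-Miranda, although v can be chosen such that x0 + v is not in
   the image of the sphere. *)
Lemma quantitative_open_image (R : realType) d (g : 'rV[R]_d -> 'rV[R]_d)
    (p c x0 : 'rV[R]_d) r L h delta : (0 < d)%N -> 0 < r -> 1 <= L -> 0 < h -> 0 < delta ->
  (forall x, cube p r x -> {for x, continuous g}) ->
  (forall x x', cube p r x -> cube p r x' -> `|g x - g x'| <= L * (`|x - x'| + h)) ->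
  (forall x x', cube p r x -> cube p r x' -> `|x - x'| <= L * (`|g x - g x'| + h)) ->
  (forall i, p 0 i + (10 * L ^+ 3 * h + 4 * L * delta) <= x0 0 i
     <= p 0 i + r - (10 * L ^+ 3 * h + 4 * L * delta)) ->
  `|c - g x0| <= delta -> (g @` cube p r) c.
Proof.
move=> d0 r0 L1 h0 delta0 gc g1 g2 x0in cx0; apply: contrapT => notc.
have L0 : 0 < L by apply: lt_le_trans L1.
set eta := 10 * L ^+ 3 * h + 4 * L * delta in x0in.
have LL : L <= L ^+ 2 by rewrite -{1}[L]expr1 ler_weXn2l.
have LL2 : L ^+ 2 <= L ^+ 3 by rewrite ler_weXn2l.
have eta0 : 0 < eta by rewrite addr_gt0// !mulr_gt0// exprn_gt0.
have x0S : cube p r x0 by move=> i; have := x0in i; lra.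
have S0 : cube p r !=set0 by exists x0.
have Sp x i : cube p r x -> p 0 i <= x 0 i by move=> /(_ i)/andP[].
pose G := coarse_inv (cube p r) L g.
have GL y y' : `|G y - G y'| <= L * `|y - y'| by exact: (coarse_inv_lipschitz g S0 Sp L0).
have GK x : cube p r x -> `|G (g x) - x| <= L * h by exact: (coarse_invK S0 Sp L0 g2).
(* The map [P] below moves [g x] by at most [2 * e], so [G (P (g x)) - v] stays within
   [2 * e * L + L * h + h <= eta] of [x]. Moreover [e] exceeds [3 * L ^+ 2 * h + delta], a bound for
   the distance from [c] to [g x] when [|x - x0| <= L * h + h]. *)
pose e := 4 * L ^+ 2 * h + 2 * delta.
have e0 : 0 < e by rewrite addr_gt0// !mulr_gt0// exprn_gt0.
have [v vh Gv] := lipschitz_sphere_avoid c x0 d0 L0 e0 h0 GL.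
pose k (y : 'rV[R]_d) := Num.max 1 (e * `|y - c|^-1).
pose P y := c + k y *: (y - c).
have gxc x : cube p r x -> 0 < `|g x - c|.
  by move=> Sx; rewrite normr_gt0 subr_eq0; apply/eqP => gx; apply: notc; exists x.
have Pin y : 0 < `|y - c| <= e -> `|P y - c| = e.
  move=> /andP[y0 ye]; rewrite /P addrC addKr normrZ /k max_r; last first.
    by rewrite ler_pdivlMr// mul1r.
  by rewrite ger0_norm ?divfK ?gt_eqF// divr_ge0// ltW.
have Pout y : 0 < `|y - c| -> e <= `|y - c| -> P y = y.
  move=> y0 ye; rewrite /P /k max_l ?scale1r; last by rewrite ler_pdivrMr// mul1r.
  by rewrite addrC subrK.
pose F x := G (P (g x)) - v - x0.
have Pg x : cube p r x -> `|P (g x) - g x| <= 2 * e.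
  move=> Sx; have [ge|/ltW eg] := leP `|g x - c| e; last first.
    by rewrite Pout ?subrr ?normr0 ?gxc// mulr_ge0// ltW.
  rewrite -(subrKA c) (le_trans (ler_normD _ _))// Pin ?gxc ?ge// (distrC c).
  by rewrite mulr2n mulrDl mul1r lerD2l.
have Fx x i : cube p r x -> `|(F x + x0 - x) 0 i| <= eta.
  move=> Sx; apply: le_trans (coord_le_norm _ _) _.
  have -> : F x + x0 - x = (G (P (g x)) - G (g x)) + (G (g x) - x) - v.
    by rewrite /F subrK addrA subrK addrAC.
  rewrite (le_trans (ler_normB _ _))// (le_trans (lerD (ler_normD _ _) vh))//.
  have := GL (P (g x)) (g x); have := GK x Sx; have := Pg x Sx.
  rewrite -(ler_pM2l L0) => h1 h2 h3.
  apply: (@le_trans _ _ (L * (2 * e) + L * h + h)); first by lra.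
  rewrite /eta /e.
  have -> : L * (2 * (4 * L ^+ 2 * h + 2 * delta)) = 8 * L ^+ 3 * h + 4 * L * delta by ring.
  nra.
have Fc x : cube p r x -> {for x, continuous F}.
  move=> Sx; pose f1 (y : 'rV[R]_d) := e * `|y - c|^-1.
  have c0 : {for x, continuous (fun x => g x - c)}.
    by apply: continuousB; [exact: gc|exact: cst_continuous].
  have c1 : {for x, continuous (fun x => `|g x - c|)}.
    apply: (continuous_comp c0); exact: norm_continuous.
  have c2 : {for x, continuous (fun x => e * `|g x - c|^-1)}.
    apply: continuousM; first exact: cst_continuous.
    by apply: continuousV => //; rewrite gt_eqF// gxc.
  have c3 : {for x, continuous (fun x => k (g x))}.
    by apply: (continuous_max (f := cst 1)) => //; exact: cst_continuous.
  have c4 : {for x, continuous (fun x => P (g x))}.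
    apply: continuousD; first exact: cst_continuous.
    exact: continuousZ.
  have c5 y : {for y, continuous G}.
    apply/(@cvgrPdist_le _ _ _ (nbhs y)) => /= t t0.
    apply/nbhs_ballP; exists (t / L) => /=; first exact: divr_gt0.
    move=> z; rewrite -ball_normE /= ltr_pdivlMr// => yz.
    by rewrite (le_trans (GL _ _))// mulrC ltW.
  apply: continuousB; last exact: cst_continuous.
  apply: continuousB; last exact: cst_continuous.
  by apply: (continuous_comp c4); exact: c5.
have [x Sx Fx0] : exists2 x, cube p r x & F x = 0.
  apply: (poincare_miranda r0 Fc) => x i Sx xi;
    have := Fx x i Sx; have := x0in i; rewrite !mxE ler_norml; lra.
have GP : G (P (g x)) = x0 + v by move/eqP: Fx0; rewrite /F -addrA -opprD subr_eq0 addrC => /eqP.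
(* Either [P (g x)] is on the sphere, whose image under [G] avoids [x0 + v], or [g x] is left in
   place and [x] is so close to [x0] that [g x] cannot be at distance [e] from [c]. *)
have [ge|/ltW eg] := leP `|g x - c| e.
  by have := Gv (P (g x)) (Pin _ _); rewrite GP eqxx gxc// => /(_ ge).
have := GK x Sx; rewrite -(Pout (g x)) ?gxc// GP => xv.
have xx0 : `|x - x0| <= L * h + h.
  rewrite -(subrKA (x0 + v)) (le_trans (ler_normD _ _))// distrC lerD//.
  by rewrite addrC addKr.
have := g1 x x0 Sx x0S; rewrite leNgt => /negP; apply.
apply: (@le_lt_trans _ _ (L * (L * h + h + h))); first by rewrite ler_pM2l// lerD2r.
have : e <= `|g x - g x0| + delta.
  by rewrite (le_trans eg)// -(subrKA (g x0)) (le_trans (ler_normD _ _))// lerD2l distrC.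
rewrite /e; nra.
Qed.

(** * Lebesgue measure and the pushforward equation *)

Section translation_invariance.
Variable R : realType.

Lemma lebesgue_measure_shift (t : R) (A : set (measurableTypeR R)) : measurable A ->
  pushforward lebesgue_measure (fun x : measurableTypeR R => x + t : measurableTypeR R) A =
  lebesgue_measure A.
Proof.
have mt : measurable_fun setT (fun x : measurableTypeR R => x + t : measurableTypeR R).
  by apply: measurable_funD => //; exact: measurable_cst.
move=> mA; apply/esym/lebesgue_measure_unique => //= _ [[a b]] _ <-.
rewrite /pushforward (_ : _ @^-1` _ = `](a - t), (b - t)]%classic).
  by rewrite !lebesgue_measure_itv/= !lte_fin ltrD2r -!EFinB opprD opprK addrACA addNr addr0.
by apply/seteqP; split => x /=; rewrite !in_itv/= ltrBlDr lerBrDr.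
Qed.

Lemma measurable_shift_rV n (v : 'rV[R]_n) : measurable_fun setT (fun w : 'rV[R]_n => w + v).
Proof.
apply/measurable_fun_rVP => i.
rewrite (_ : (fun _ => _) = fun w : 'rV[R]_n => w 0 i + v 0 i); last first.
  by apply/funext => w; rewrite mxE.
by apply: measurable_funD; [exact: measurable_coord_rV|exact: measurable_cst].
Qed.

(** Sections are shifted by the induction hypothesis, the first coordinate by the one-dimensional
    case. *)
Lemma lebesgue_rV_shift n (v : 'rV[R]_n) (A : set 'rV[R]_n) : measurable A ->
  lebesgue_rV ((fun w => w + v) @^-1` A) = lebesgue_rV A.
Proof.
elim: n v A => [|n IHn] v A mA.
  by rewrite (_ : (fun w : 'rV_0 => w + v) = id) ?preimage_id//; apply/funext => w; rewrite [LHS]thinmx0 [RHS]thinmx0.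
rewrite /= /pushforward /product_measure1.
have mB : measurable (@consrV R n @^-1` A).
  by rewrite -[X in measurable X]setTI; exact: measurable_consrV.
set B := _ @^-1` A in mB *.
pose sh (x : measurableTypeR R) : measurableTypeR R := x + v 0 0.
have mt : measurable_fun setT sh by apply: measurable_funD => //; exact: measurable_cst.
pose v' : 'rV[R]_n := \row_j v 0 (lift 0 j).
transitivity (\int[@lebesgue_measure R]_x (((@lebesgue_rV R n) \o xsection B) \o sh) x)%E.
  apply: eq_integral => x _ /=; rewrite -[RHS](IHn v'); last exact: measurable_xsection.
  congr lebesgue_rV; apply/seteqP; split => w;
    rewrite /xsection/= !inE /B/=; congr A; apply/rowP => i; rewrite !mxE;
    (case: splitP => [j ij|j ij]; rewrite !mxE ?ord1 ?eqxx ?mulr1n;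
     congr (_ + v _ _); apply/ord_inj; by rewrite ij ?ord1).
rewrite -(@ge0_integral_pushforward _ _ _ _ _ _ mt lebesgue_measure setT)//; last first.
  exact: measurable_fun_xsection.
by apply: eq_measure_integral => C mC _; exact: lebesgue_measure_shift.
Qed.

End translation_invariance.

Section density.
Variables (R : realType) (d : nat).

Lemma closed_measurable_rV (A : set 'rV[R]_d) : closed A -> measurable A.
Proof.
by rewrite -openC => /open_measurable_rV/measurableC; rewrite setCK.
Qed.

Lemma compact_measurable_rV (A : set 'rV[R]_d) : compact A -> measurable A.
Proof.
by move=> /(compact_closed (@norm_hausdorff _ _))/closed_measurable_rV.
Qed.

Lemma continuous_measurable_rV (A : set 'rV[R]_d) (rho : 'rV[R]_d -> R) :
  continuous rho -> measurable_fun A (EFin \o rho).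
Proof.
move=> rc; apply/measurable_EFinP; apply: measurable_funTS.
apply: (measurability _ (RGenOpens.measurableE R)) => _ [_ [a [b ->] <-]].
rewrite setTI; apply: open_measurable_rV.
by apply: (@open_comp _ _ rho); [move=> v _; exact: rc|exact: interval_open].
Qed.

(** For compact [C] in the cube, the equation tested on the Borel set [f(C)] identifies the mass of
    [C] with the volume of [f(C)], as injectivity makes [C] the full preimage. The volumes are
    compared by translation. *)
Lemma pushforward_translate_le (rho : 'rV[R]_d -> R) (f : 'rV[R]_d -> 'rV[R]_d)
    (A B : set 'rV[R]_d) (w : 'rV[R]_d) :
  set_inj (unit_cube d) f -> {within unit_cube d, continuous f} ->
  pushforward_equation rho f ->
  compact A -> compact B -> A `<=` unit_cube d -> B `<=` unit_cube d ->
  (forall x, A x -> (f @` B) (f x + w)) ->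
  (\int[@lebesgue_rV R d]_(x in A) (rho x)%:E <= \int[@lebesgue_rV R d]_(x in B) (rho x)%:E)%E.
Proof.
move=> fi fc pe cA cB AQ BQ AB.
have cf C : compact C -> C `<=` unit_cube d -> compact (f @` C).
  by move=> cC CQ; apply: continuous_compact => //; exact: continuous_subspaceW fc.
have pf C : compact C -> C `<=` unit_cube d ->
    (\int[@lebesgue_rV R d]_(x in C) (rho x)%:E)%E = lebesgue_rV (f @` C).
  move=> cC CQ; have mfC := compact_measurable_rV (cf C cC CQ).
  have := pe _ mfC; rewrite setIidl; last exact: image_subset.
  move=> <-; rewrite /pushforward /density_measure; congr integral.
  apply/seteqP; split => [x Cx|x [Qx [y Cy fyx]]].
    by split; [exact: CQ|exists x].
  by rewrite -(fi y x)// inE//; exact: CQ.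
rewrite !pf//.
have mfB := compact_measurable_rV (cf B cB BQ).
rewrite -(lebesgue_rV_shift w mfB); apply: le_measure.
- by rewrite inE; exact: compact_measurable_rV (cf A cA AQ).
- rewrite inE -[X in measurable X]setTI; exact: measurable_shift_rV.
- by move=> _ [x Ax <-]; exact: AB.
Qed.

End density.

(** * Increments of almost maximally stretched paths *)

Section euclidean_norm.
Variables (R : realType) (d : nat).
Implicit Types (u v w : 'rV[R]_d).

Definition dot u v := \sum_i u 0 i * v 0 i.

Lemma norm2_ge0 v : 0 <= norm2 v. Proof. exact: sqrtr_ge0. Qed.

Lemma sqr_norm2 v : norm2 v ^+ 2 = dot v v.
Proof.
rewrite /norm2 sqr_sqrtr; first by apply: eq_bigr => i _; rewrite expr2.
by apply: sumr_ge0 => i _; exact: sqr_ge0.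
Qed.

Lemma norm_le_norm2 v : `|v| <= norm2 v.
Proof.
apply: norm_rV_le => [|i]; first exact: norm2_ge0.
rewrite -sqrtr_sqr ler_wsqrtr// (bigD1 i)//= lerDl.
by apply: sumr_ge0 => j _; exact: sqr_ge0.
Qed.

Lemma norm2_le_norm v : norm2 v <= d%:R * `|v|.
Proof.
have n0 : 0 <= d%:R * `|v| by rewrite mulr_ge0.
rewrite -(ler_pXn2r (n := 2))// ?nnegrE ?norm2_ge0// sqr_norm2 exprMn.
apply: (@le_trans _ _ (\sum_(i < d) `|v| ^+ 2)).
  apply: ler_sum => i _; rewrite -expr2 -real_normK ?num_real//.
  by rewrite ler_pXn2r// ?nnegrE// coord_le_norm.
rewrite sumr_const card_ord -[leLHS]mulr_natl ler_wpM2r ?sqr_ge0//.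
case: (d) => [|n]; first by rewrite expr0n.
by rewrite expr2 ler_peMr// ler1n.
Qed.

Lemma dotDl u v w : dot (u + v) w = dot u w + dot v w.
Proof. by rewrite -big_split; apply: eq_bigr => i _; rewrite mxE mulrDl. Qed.

Lemma dotC u v : dot u v = dot v u.
Proof. by apply: eq_bigr => i _; rewrite mulrC. Qed.

Lemma dotZl (a : R) u v : dot (a *: u) v = a * dot u v.
Proof. by rewrite /dot mulr_sumr; apply: eq_bigr => i _; rewrite mxE mulrA. Qed.

Lemma dot_suml (I : Type) (r : seq I) (P : pred I) (F : I -> 'rV[R]_d) v :
  dot (\sum_(i <- r | P i) F i) v = \sum_(i <- r | P i) dot (F i) v.
Proof.
elim/big_rec2 : _ => [|i x y _ <-]; last by rewrite dotDl.
by rewrite /dot big1// => i _; rewrite mxE mul0r.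
Qed.

Lemma sqr_norm2B u (a : R) v :
  norm2 (u - a *: v) ^+ 2 = norm2 u ^+ 2 - 2 * a * dot u v + a ^+ 2 * norm2 v ^+ 2.
Proof.
rewrite !sqr_norm2 /dot !mulr_sumr -sumrB -big_split/=.
by apply: eq_bigr => i _; rewrite !mxE; ring.
Qed.

Lemma norm2Z (a : R) v : norm2 (a *: v) = `|a| * norm2 v.
Proof.
rewrite /norm2 -sqrtr_sqr -sqrtrM ?sqr_ge0//; congr Num.sqrt.
by rewrite mulr_sumr; apply: eq_bigr => i _; rewrite mxE exprMn.
Qed.

Lemma dot_le_norm u v : `|dot u v| <= d%:R * `|u| * `|v|.
Proof.
rewrite (le_trans (ler_norm_sum _ _ _))// -mulrA.
rewrite (le_trans (ler_sum _ (G := fun=> `|u| * `|v|) _))//.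
  by move=> i _; rewrite normrM ler_pM// coord_le_norm.
by rewrite sumr_const card_ord mulr_natl.
Qed.

Lemma norm2_eq0 v : (norm2 v == 0) = (v == 0).
Proof.
apply/eqP/eqP => [v0|->].
  by apply/eqP; rewrite -normr_le0 (le_trans (norm_le_norm2 v))// v0.
by rewrite /norm2 big1 ?sqrtr0// => i _; rewrite mxE expr0n.
Qed.

Lemma norm2_eq_sub0 u v : (norm2 (u - v) == 0) = (u == v).
Proof. by rewrite norm2_eq0 subr_eq0. Qed.

Lemma norm2B_gt0 u v : (0 < norm2 (u - v)) = (u != v).
Proof. by rewrite lt0r norm2_ge0 andbT norm2_eq_sub0. Qed.

End euclidean_norm.

Lemma sum_double (R : zmodType) n (F : nat -> R) :
  \sum_(i < n.*2) F i = \sum_(i < n) (F i.*2 + F i.*2.+1).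
Proof.
by elim: n => [|n IH]; rewrite ?big_ord0// doubleS !big_ord_recr/= IH addrA.
Qed.

Lemma exists_le_average (R : realFieldType) n (F : 'I_n -> R) (B : R) : (0 < n)%N ->
  \sum_i F i <= n%:R * B -> exists i, F i <= B.
Proof.
case: n F => // n F _ sumF; pose i0 := [arg min_(i < ord0) F i]%O.
exists i0; rewrite -(ler_pM2l (ltr0Sn R n)) (le_trans _ sumF)//.
rewrite mulr_natl -[n.+1 in leLHS]card_ord -sumr_const; apply: ler_sum => i _.
by rewrite /i0; case: arg_minP => // j _ /(_ i isT).
Qed.

(* If the 2n increments of a path are not longer than (1+k)a while the path has length at
   least 2na, then most increments are close to one and the same vector v. This is applied
   to a finite family of paths at once. *)
Lemma almost_equal_increments (R : realType) d (I : finType) n (w : nat -> I -> 'rV[R]_d)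
    (W : 'rV[R]_d) (a k err : R) : (0 < n)%N -> 0 < a -> 0 <= k -> 0 <= err ->
  (forall i s, (i < n.*2)%N -> norm2 (w i s) <= (1 + k) * a) ->
  (forall s, `|\sum_(i < n.*2) w i s - W| <= err) ->
  n.*2%:R * a <= norm2 W ->
  exists v, exists2 i, (i < n)%N &
    forall s, norm2 (w i.*2 s - v) ^+ 2 <=
      k ^+ 2 * a ^+ 2 + 2 * (#|I|%:R * (2 * k * a ^+ 2 + d%:R * err * a / n%:R)).
Proof.
move=> n0 a0 k0 err0 wk sumw aW.
have nR : 0 < n%:R :> R by rewrite ltr0n.
have W0 : 0 < norm2 W by apply: lt_le_trans aW; rewrite mulr_gt0// ltr0n double_gt0.
pose v := (a / norm2 W) *: W.
have v2 : norm2 v = a.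
  by rewrite /v norm2Z ger0_norm ?divfK ?gt_eqF// divr_ge0// ltW.
(* Slack in direction [v]. It is nonnegative because [w] has length at most [(1 + k) * a], has a
   small sum because the increments add up to nearly [W], and gives the claim through
   [|w - v|^2 <= k^2 a^2 + 2 D]. *)
pose D i s := (1 + k) * a ^+ 2 - dot (w i s) v.
have D0 i s : (i < n.*2)%N -> 0 <= D i s.
  move=> iN; have := sqr_ge0 (norm2 (w i s - (1 + k) *: v)).
  rewrite sqr_norm2B v2 /D => h.
  have k1 : 0 < 1 + k by rewrite ltr_pwDl.
  have : norm2 (w i s) ^+ 2 <= ((1 + k) * a) ^+ 2.
    by rewrite ler_pXn2r// ?wk// nnegrE ?norm2_ge0// mulr_ge0// ltW.
  rewrite exprMn => h2; rewrite -(pmulr_rge0 _ k1) mulrBr; lra.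
pose B := 2 * k * n%:R * a ^+ 2 + d%:R * err * a.
have sumD s : \sum_(i < n.*2) D i s <= B.
  rewrite sumrB sumr_const card_ord -dot_suml.
  set Z := \sum_(i < _) _.
  have -> : Z = W + (Z - W) by rewrite addrC subrK.
  rewrite dotDl.
  have -> : dot W v = a * norm2 W.
    by rewrite dotC dotZl -sqr_norm2 expr2 mulrA divfK ?gt_eqF.
  have := dot_le_norm (Z - W) v.
  have : d%:R * `|Z - W| * `|v| <= d%:R * err * a.
    by rewrite ler_pM ?mulr_ge0// ?ler_wpM2l// ?sumw// -v2 norm_le_norm2.
  rewrite ler_norml => h1 /andP[h2 _].
  have h3 : 2 * n%:R * a ^+ 2 <= a * norm2 W.
    rewrite expr2 mulrA mulrC ler_pM2l//; move: aW.
    by rewrite -mul2n natrM.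
  rewrite -[_ *+ n.*2]mulr_natl /B -mul2n natrM; lra.
(* One index has to serve all [s], so the slacks are added over [s] before averaging, at the cost of
   a factor [#|I|]. Even indices suffice: a cell will be compared with its right neighbour. *)
have sumD2 : \sum_(i < n) \sum_s D i.*2 s <= #|I|%:R * B.
  rewrite exchange_big/= mulr_natl -sumr_const; apply: ler_sum => s _.
  apply: le_trans (sumD s); rewrite (sum_double n (fun i => D i s)).
  apply: ler_sum => i _; rewrite lerDl D0//.
  by rewrite -doubleS leq_double.
have [i iB] : exists i : 'I_n, \sum_s D i.*2 s <= #|I|%:R * B / n%:R.
  by apply: exists_le_average => //; rewrite mulrC divfK// gt_eqF.
exists v, i => // s.
have DB : D i.*2 s <= #|I|%:R * B / n%:R.
  apply: le_trans iB; rewrite (bigD1 s)//= lerDl; apply: sumr_ge0 => t _.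
  by rewrite D0// ltn_double.
have -> : w i.*2 s - v = w i.*2 s - 1 *: v by rewrite scale1r.
have i2n : (i.*2 < n.*2)%N by rewrite ltn_double.
have w2 : norm2 (w i.*2 s) ^+ 2 <= ((1 + k) * a) ^+ 2.
  rewrite ler_pXn2r// ?wk// nnegrE ?norm2_ge0// mulr_ge0// ltW//.
  by rewrite ltr_pwDl.
rewrite sqr_norm2B v2; move: w2 DB; rewrite exprMn /D.
have -> : #|I|%:R * B / n%:R = #|I|%:R * (2 * k * a ^+ 2 + d%:R * err * a / n%:R).
  by rewrite /B; field; rewrite gt_eqF.
lra.
Qed.

(** * The density *)

Section oscillating_density.
Variables (R : realType) (ell hh c : nat -> R).
Hypotheses (ell_gt0 : forall j, 0 < ell j) (ell_hh : forall j, 4 * ell j.+1 <= hh j).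
Hypotheses (c_ge0 : forall j, 0 <= c j) (c_le : forall j, c j.+1 <= c j).

Let hh_gt0 j : 0 < hh j.
Proof. by rewrite (lt_le_trans _ (ell_hh j))// mulr_gt0. Qed.

(** A continuous cutoff of period [hh j]. The angle [w] corresponds to the length [ell j.+1]; the
    comparisons with [cos w] and [cos (2 * w)] test whether [y] is within [ell j.+1], or at least
    [2 * ell j.+1] away, from the nearest translate of the centre [ell j.+1]. The plateau has width
    [2 * ell j.+1], so a cell of side [ell j.+1] fits wherever its corner lies in the first half. *)
Definition stripe j (y : R) : R :=
  let w := 2 * pi * ell j.+1 / hh j in
  Num.max 0 (Num.min 1 ((cos (2 * pi * (y - ell j.+1) / hh j) - cos (2 * w)) /
                        (cos w - cos (2 * w)))).

Definition stripes j y : R := \prod_(m < j.+1) stripe m y.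

Definition wave j (x : R) : R := Num.max 0 (sin (pi * x / ell j.+1)).

(** The weights [stripes j - stripes j.+1] telescope, so for decreasing [c] the tail from [n] on is
    at most [c n]. Uniform convergence thus asks only for [c] to tend to zero, and the amplitudes
    chosen later are indeed not summable. *)
Definition wave_sum n (x y : R) : R :=
  1 + \sum_(j < n) c j * wave j x * (stripes j y - stripes j.+1 y).

Definition wave_density (x y : R) : R := limn (fun n => wave_sum n x y).

Lemma stripe01 j y : 0 <= stripe j y <= 1.
Proof. by rewrite le_max lexx/= ge_max ler01/= ge_min lexx. Qed.

Lemma wave01 j x : 0 <= wave j x <= 1.
Proof. by rewrite le_max lexx/= ge_max ler01/= sin_le1. Qed.

Lemma stripesS j y : stripes j.+1 y = stripes j y * stripe j.+1 y.
Proof. by rewrite /stripes big_ord_recr. Qed.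

Lemma stripes01 j y : 0 <= stripes j y <= 1.
Proof.
rewrite /stripes prodr_ge0/=; last by move=> i _; have /andP[] := stripe01 i y.
by apply: prodr_ile1 => i _; exact: stripe01.
Qed.

Lemma stripes_le j y : stripes j.+1 y <= stripes j y.
Proof.
rewrite stripesS ler_piMr//; first by have /andP[] := stripes01 j y.
by have /andP[] := stripe01 j.+1 y.
Qed.

Let angle_bounds j :
  let w := 2 * pi * ell j.+1 / hh j in 0 < w /\ 2 * w <= pi.
Proof.
have pi0 := @pi_gt0 R; split; first by rewrite divr_gt0 ?mulr_gt0.
rewrite (_ : 2 * _ = pi * (4 * ell j.+1 / hh j)); last by field; rewrite gt_eqF.
by rewrite ler_piMr ?(ltW pi0)// ler_pdivrMr// mul1r.
Qed.

Let cosD2pin (x : R) k : cos (x + 2 * pi * k%:R) = cos x.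
Proof.
elim: k => [|k IH]; first by rewrite mulr0 addr0.
have := cosD2pi (x + 2 * pi * k%:R); rewrite -[pi *+ 2]mulr_natl -addrA => E.
by rewrite -[in RHS]IH -[RHS]E -(natr1 k) mulrDr mulr1.
Qed.

Let cos_le (x y : R) : 0 <= x -> x <= y -> y <= pi -> cos y <= cos x.
Proof.
move=> x0; rewrite le_eqVlt => /predU1P[->//|xy] ypi.
have ltx : x <= pi by rewrite (le_trans (ltW xy)).
by rewrite ltW// ltr_cos// in_itv/= ?x0 ?ltx// ypi (le_trans x0)// ltW.
Qed.

Lemma stripe1 j k t : 0 <= t <= 2 * ell j.+1 -> stripe j (k%:R * hh j + t) = 1.
Proof.
move=> t2; have [w0 w2] := angle_bounds j; have pi0 := @pi_gt0 R.
rewrite /stripe; set w := _ / _ in w0 w2 *.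
have den : 0 < cos w - cos (2 * w).
  by rewrite subr_gt0 ltr_cos ?in_itv/=; lra.
rewrite min_l ?max_r// ler_pdivlMr// mul1r lerD2r.
have -> : 2 * pi * (k%:R * hh j + t - ell j.+1) / hh j =
  2 * pi * (t - ell j.+1) / hh j + 2 * pi * k%:R by field; rewrite gt_eqF.
rewrite cosD2pin -(cos_norm (2 * pi * (t - ell j.+1) / hh j)); apply: cos_le => //; last by lra.
rewrite !normrM !(gtr0_norm pi0) normfV (gtr0_norm (hh_gt0 j)) ger0_norm//.
rewrite ler_pM2r ?invr_gt0// ler_pM2l ?mulr_gt0// ler_norml; lra.
Qed.

Lemma stripe0 j k t : 3 * ell j.+1 <= t <= hh j - ell j.+1 ->
  stripe j (k%:R * hh j + t) = 0.
Proof.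
move=> t2; have [w0 w2] := angle_bounds j; have pi0 := @pi_gt0 R.
rewrite /stripe; set w := _ / _ in w0 w2 *.
have den : 0 < cos w - cos (2 * w).
  by rewrite subr_gt0 ltr_cos ?in_itv/=; lra.
rewrite max_l// ge_min; apply/orP; right.
rewrite pmulr_lle0 ?invr_gt0// subr_le0.
have -> : 2 * pi * (k%:R * hh j + t - ell j.+1) / hh j =
  2 * pi * (t - ell j.+1) / hh j + 2 * pi * k%:R by field; rewrite gt_eqF.
rewrite cosD2pin; set phi := (X in cos X <= _).
have phi_lo : 2 * w <= phi.
  rewrite -subr_ge0.
  have -> : phi - 2 * w = 2 * pi * (t - 3 * ell j.+1) / hh j.
    by rewrite /phi /w; field; rewrite gt_eqF.
  rewrite divr_ge0 ?(ltW (hh_gt0 j))// mulr_ge0//; last by lra.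
  by rewrite mulr_ge0 ?(ltW pi0).
have phi_hi : phi <= 2 * pi - 2 * w.
  rewrite -subr_ge0.
  have -> : 2 * pi - 2 * w - phi = 2 * pi * (hh j - ell j.+1 - t) / hh j.
    by rewrite /phi /w; field; rewrite gt_eqF.
  rewrite divr_ge0 ?(ltW (hh_gt0 j))// mulr_ge0//; last by lra.
  by rewrite mulr_ge0 ?(ltW pi0).
have [phipi|piphi] := leP phi pi; first by apply: cos_le => //; lra.
have -> : cos phi = cos (2 * pi - phi).
  by rewrite -[RHS]cosN opprB -[RHS](cosD2pin (phi - 2 * pi) 1) mulr1 subrK.
by apply: cos_le; lra.
Qed.

Let sinD2pin (x : R) k : sin (x + 2 * pi * k%:R) = sin x.
Proof.
elim: k => [|k IH]; first by rewrite mulr0 addr0.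
have := sinD2pi (x + 2 * pi * k%:R); rewrite -[pi *+ 2]mulr_natl -addrA => E.
by rewrite -[in RHS]IH -[RHS]E -(natr1 k) mulrDr mulr1.
Qed.

Lemma wave_even j k t : ell j.+1 / 4 <= t <= 3 * ell j.+1 / 4 ->
  cos (pi / 4) <= wave j (k.*2%:R * ell j.+1 + t).
Proof.
move=> tin; have pi0 := @pi_gt0 R.
rewrite le_max; apply/orP; right.
have -> : pi * (k.*2%:R * ell j.+1 + t) / ell j.+1 =
   pi * t / ell j.+1 + 2 * pi * k%:R.
  by rewrite -mul2n natrM; field; rewrite gt_eqF.
rewrite sinD2pin -cosBpihalf -(cos_norm (_ - _)).
have -> : pi * t / ell j.+1 - pi / 2 = pi * (t / ell j.+1 - 2^-1).
  by field; rewrite gt_eqF.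
have l0 := ell_gt0 j.+1.
have h1 : 4^-1 <= t / ell j.+1 by rewrite ler_pdivlMr// mulrC; lra.
have h2 : t / ell j.+1 <= 3 / 4 by rewrite ler_pdivrMr// mulrAC; lra.
rewrite normrM (gtr0_norm pi0); apply: cos_le.
- by rewrite mulr_ge0// ltW.
- by rewrite ler_pM2l// ler_norml; lra.
- lra.
Qed.

Lemma wave_odd j k t : 0 <= t <= ell j.+1 -> wave j (k.*2.+1%:R * ell j.+1 + t) = 0.
Proof.
move=> tin; have l0 := ell_gt0 j.+1; have pi0 := @pi_gt0 R; apply: max_l.
have -> : pi * (k.*2.+1%:R * ell j.+1 + t) / ell j.+1 =
   pi * t / ell j.+1 + pi + 2 * pi * k%:R.
  by rewrite -natr1 -mul2n natrM; field; rewrite gt_eqF.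
rewrite sinD2pin sinDpi oppr_le0 sin_ge0_pi//.
by rewrite divr_ge0 ?mulr_ge0 ?(ltW pi0)//= ?ler_pdivrMr// ?ler_pM2l//; lra.
Qed.

Let term_ge0 j x y : 0 <= c j * wave j x * (stripes j y - stripes j.+1 y).
Proof.
rewrite !mulr_ge0// ?subr_ge0 ?stripes_le//.
by have /andP[] := wave01 j x.
Qed.

Lemma wave_sum_le x y : nondecreasing_seq (fun n => wave_sum n x y).
Proof.
by apply/nondecreasing_seqP => n; rewrite /wave_sum big_ord_recr/= addrA lerDl.
Qed.

Let c_anti n m : (n <= m)%N -> c m <= c n.
Proof. by move: n m; apply/nonincreasing_seqP. Qed.

Lemma wave_sum_tail n m x y : (n <= m)%N ->
  wave_sum m x y <= wave_sum n x y + c n * (stripes n y - stripes m y).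
Proof.
move=> /subnK <-; elim: (m - n)%N => [|k IH]; first by rewrite add0n subrr mulr0 addr0.
rewrite addSn /wave_sum big_ord_recr/= addrA.
have /andP[w0 w1] := wave01 (k + n) x.
have s0 : 0 <= stripes (k + n) y - stripes (k + n).+1 y by rewrite subr_ge0 stripes_le.
have : c (k + n)%N * wave (k + n) x * (stripes (k + n) y - stripes (k + n).+1 y) <=
    c n * (stripes (k + n) y - stripes (k + n).+1 y).
  rewrite ler_wpM2r// (le_trans _ (c_anti (leq_addl k n)))// ler_piMr//.
move: IH; rewrite /wave_sum !mulrBr; lra.
Qed.

Lemma wave_sum_bound n m x y : (n <= m)%N ->
  wave_sum m x y <= wave_sum n x y + c n * stripes n y.
Proof.
move=> nm; apply: le_trans (wave_sum_tail x y nm) _.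
rewrite lerD2l ler_wpM2l// gerBl.
by have /andP[] := stripes01 m y.
Qed.

Let wave_sum_cvg x y : cvgn (fun n => wave_sum n x y).
Proof.
apply: nondecreasing_is_cvgn; first exact: wave_sum_le.
exists (wave_sum 0 x y + c 0 * stripes 0 y) => _ [n _ <-].
exact: wave_sum_bound.
Qed.

Lemma wave_sum_le_density n x y : wave_sum n x y <= wave_density x y.
Proof. by apply: nondecreasing_cvgn_le; [exact: wave_sum_le|exact: wave_sum_cvg]. Qed.

Lemma density_le_wave_sum n x y :
  wave_density x y <= wave_sum n x y + c n * stripes n y.
Proof.
apply: limr_le; first exact: wave_sum_cvg.
by exists n => // m /= nm; exact: wave_sum_bound.
Qed.

Lemma wave_density_ge1 x y : 1 <= wave_density x y.
Proof.
by rewrite (le_trans _ (wave_sum_le_density 0 x y))// /wave_sum big_ord0 addr0.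
Qed.

Section core.
Variables (j : nat) (x y : R).
Hypothesis stripe_le1 : forall m, (m <= j)%N -> stripe m y = 1.

Let stripes_core m : (m <= j)%N -> stripes m y = 1.
Proof.
by move=> mj; rewrite /stripes big1// => i _; rewrite stripe_le1// (leq_trans _ mj)// -ltnS.
Qed.

Let wave_sum_core : wave_sum j x y = 1.
Proof.
rewrite /wave_sum big1 ?addr0// => i _.
by rewrite !stripes_core ?subrr ?mulr0// ltnW.
Qed.

Lemma wave_density_core_le : wave_density x y <= 1 + c j.
Proof.
by rewrite (le_trans (density_le_wave_sum j x y))// wave_sum_core stripes_core// mulr1.
Qed.

(** Where the stripes up to [j] equal [1] the weights of all earlier stages vanish, and off the next
    stripe those of all later stages. *)
Lemma wave_density_core : stripe j.+1 y = 0 -> wave_density x y = 1 + c j * wave j x.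
Proof.
move=> s0; have sj1 : stripes j.+1 y = 0 by rewrite stripesS s0 mulr0.
have E : wave_sum j.+1 x y = 1 + c j * wave j x.
  have := wave_sum_core; rewrite /wave_sum big_ord_recr/= addrA => ->.
  by rewrite stripes_core// sj1 subr0 mulr1.
apply/eqP; rewrite eq_le -E wave_sum_le_density andbT.
by rewrite (le_trans (density_le_wave_sum j.+1 x y))// sj1 mulr0 addr0.
Qed.

End core.

Hypothesis c_small : forall e, 0 < e -> exists n, c n < e.

Lemma wave_density_continuous d (i1 i2 : 'I_d) :
  continuous (fun v : 'rV[R]_d => wave_density (v 0 i1) (v 0 i2)).
Proof.
have cc i : continuous (fun v : 'rV[R]_d => v 0 i) by exact: coord_continuous.
have affine_c (a b e : R) y : {for y, continuous (fun y : R => a * (y - b) / e)}.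
  apply: continuousM; last exact: cst_continuous.
  apply: continuousM; first exact: cst_continuous.
  by apply: continuousB; [exact: cvg_id|exact: cst_continuous].
have stripe_c j y : {for y, continuous (stripe j)}.
  apply: (continuous_max (f := cst 0)); first exact: cst_continuous.
  apply: (continuous_min (f := cst 1)); first exact: cst_continuous.
  apply: continuousM; last exact: cst_continuous.
  apply: continuousB; last exact: cst_continuous.
  by apply: (continuous_comp (affine_c _ _ _ y)); exact: continuous_cos.
have wave_c j y : {for y, continuous (wave j)}.
  apply: (continuous_max (f := cst 0)); first exact: cst_continuous.
  apply: (continuous_comp (f := fun y => pi * y / ell j.+1)); last exact: continuous_sin.
  apply: continuousM; last exact: cst_continuous.
  by apply: continuousM; [exact: cst_continuous|exact: cvg_id].
have stripes_c j y : {for y, continuous (stripes j)}.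
  elim: j => [|j IH].
    rewrite (_ : stripes 0 = stripe 0); first exact: stripe_c.
    by apply/funext => z; rewrite /stripes big_ord1.
  rewrite (_ : stripes j.+1 = fun y => stripes j y * stripe j.+1 y).
    by apply: continuousM; [exact: IH|exact: stripe_c].
  by apply/funext => z; rewrite stripesS.
have sum_c n v : {for v, continuous (fun v : 'rV[R]_d => wave_sum n (v 0 i1) (v 0 i2))}.
  elim: n => [|n IH].
    rewrite (_ : (fun _ => _) = cst 1); first exact: cst_continuous.
    by apply/funext => w; rewrite /wave_sum big_ord0 addr0.
  rewrite (_ : (fun _ => _) = fun v : 'rV[R]_d => wave_sum n (v 0 i1) (v 0 i2) +
     c n * wave n (v 0 i1) * (stripes n (v 0 i2) - stripes n.+1 (v 0 i2))); last first.
    by apply/funext => w; rewrite /wave_sum big_ord_recr/= addrA.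
  apply: continuousD; first exact: IH.
  apply: continuousM.
    apply: continuousM; first exact: cst_continuous.
    by apply: (continuous_comp (cc i1 v)); exact: wave_c.
  by apply: continuousB; apply: (continuous_comp (cc i2 v)); exact: stripes_c.
move=> v; apply/(@cvgrPdist_lt _ _ _ (nbhs v)) => /= e e0.
have e3 : 0 < e / 3 by rewrite divr_gt0.
have [n cn] := c_small e3.
have := sum_c n v; move=> /(@cvgrPdist_lt _ _ _ (nbhs v))/(_ _ e3); apply: filterS => w.
have bound (u : 'rV[R]_d) : wave_sum n (u 0 i1) (u 0 i2) <= wave_density (u 0 i1) (u 0 i2)
    <= wave_sum n (u 0 i1) (u 0 i2) + c n.
  rewrite wave_sum_le_density (le_trans (density_le_wave_sum n _ _))// lerD2l.
  by rewrite ler_piMr//; have /andP[] := stripes01 n (u 0 i2).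
have := bound v; have := bound w; rewrite !ltr_norml; lra.
Qed.

End oscillating_density.

(** * Masses of neighbouring cells *)

Section integral_bounds.
Context d (T : measurableType d) (R : realType) (mu : {measure set T -> \bar R}).
Variables (S G : set T) (rho : T -> R) (c : R).
Hypotheses (mS : measurable S) (mG : measurable G) (c0 : 0 <= c).
Hypothesis mrho : measurable_fun S (EFin \o rho).
Hypothesis rho0 : forall x, S x -> 0 <= rho x.

Let step_integral :
  (\int[mu]_(x in S) (1 + c * \1_G x)%:E = mu S + c%:E * mu (G `&` S))%E.
Proof.
under eq_integral do rewrite EFinD EFinM.
have mI : measurable_fun S (fun x => (\1_G x)%:E : \bar R).
  by apply/measurable_EFinP; exact: measurable_indic.
rewrite ge0_integralD//.
- by rewrite integral_cst// mul1e ge0_integralZl// integral_indic.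
- by move=> x _; rewrite -EFinM lee_fin mulr_ge0.
- by apply: measurable_funeM.
Qed.

Let measurable_step : measurable_fun S (EFin \o (fun x => 1 + c * \1_G x)).
Proof.
apply/measurable_EFinP; apply: measurable_funD; first exact: measurable_cst.
by apply: measurable_funM; [exact: measurable_cst|exact: measurable_indic].
Qed.

Lemma integral_le_step :
  (forall x, S x -> rho x <= 1 + c) -> (forall x, S x -> ~ G x -> rho x <= 1) ->
  (\int[mu]_(x in S) (rho x)%:E <= mu S + c%:E * mu (G `&` S))%E.
Proof.
move=> rho_le rho1; rewrite -step_integral; apply: ge0_le_integral => //.
move=> x Sx; rewrite lee_fin indicE.
have [Gx|Gx] := pselect (G x); first by rewrite mem_set// mulr1 rho_le.
by rewrite memNset// mulr0 addr0 rho1.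
Qed.

Lemma integral_ge_step :
  (forall x, S x -> 1 <= rho x) -> (forall x, S x -> G x -> 1 + c <= rho x) ->
  (mu S + c%:E * mu (G `&` S) <= \int[mu]_(x in S) (rho x)%:E)%E.
Proof.
move=> rho_ge rho1; rewrite -step_integral; apply: ge0_le_integral => //.
  by move=> x Sx; rewrite lee_fin addr_ge0// mulr_ge0.
move=> x Sx; rewrite lee_fin indicE.
have [Gx|Gx] := pselect (G x); first by rewrite mem_set// mulr1 rho1.
by rewrite memNset// mulr0 addr0 rho_ge.
Qed.

End integral_bounds.

Section box_measure.
Variables (R : realType) (d : nat).

Definition box (lo hi : 'I_d -> R) : set 'rV[R]_d :=
  [set v | forall i, lo i <= v 0 i <= hi i].

Lemma box_measure (lo hi : 'I_d -> R) : (forall i, lo i <= hi i) ->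
  lebesgue_rV (box lo hi) = (\prod_i (hi i - lo i))%:E.
Proof.
move=> lohi.
have -> : box lo hi = [set v : 'rV[R]_d | forall i, `[lo i, hi i]%classic (v 0 i)].
  by apply/seteqP; split => v /= h i; have := h i; rewrite in_itv.
rewrite (lebesgue_rV_prod (A := fun i => `[lo i, hi i]%classic))//.
rewrite -prodEFin; apply: eq_bigr => i _; rewrite lebesgue_measure_itv/= lte_fin.
by have := lohi i; rewrite le_eqVlt => /predU1P[->|->//]; rewrite ltxx subrr.
Qed.

Lemma box_closed (lo hi : 'I_d -> R) : closed (box lo hi).
Proof.
have -> : box lo hi = \bigcap_(i in [set: 'I_d])
    ((fun v : 'rV[R]_d => v 0 i) @^-1` `[lo i, hi i]%classic).
  apply/seteqP; split => v /= h i; first by move=> _; rewrite /= in_itv; exact: h.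
  by have := h i I; rewrite /= in_itv.
apply: closed_bigI => i _; apply: closed_comp; last exact: interval_closed.
by move=> v _; exact: coord_continuous.
Qed.

Lemma measurable_box (lo hi : 'I_d -> R) : measurable (box lo hi).
Proof. by apply: closed_measurable_rV; exact: box_closed. Qed.

Lemma cube_box (p : 'rV[R]_d) (r : R) : cube p r = box (fun i => p 0 i) (fun i => p 0 i + r).
Proof. by []. Qed.

Lemma cube_measure (p : 'rV[R]_d) (r : R) : 0 <= r -> lebesgue_rV (cube p r) = (r ^+ d)%:E.
Proof.
move=> r0; rewrite cube_box box_measure; last by move=> i; rewrite lerDl.
by under eq_bigr do rewrite addrAC subrr add0r; rewrite prodr_const card_ord.
Qed.

Lemma measurable_cube (p : 'rV[R]_d) (r : R) : measurable (cube p r).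
Proof. exact: measurable_box. Qed.

Definition slab (p : 'rV[R]_d) r i0 (a s : R) :=
  box (fun i => if i == i0 then a else p 0 i)
      (fun i => if i == i0 then a + s else p 0 i + r).

Lemma slab_measure p r i0 a s : 0 <= r -> 0 <= s ->
  lebesgue_rV (slab p r i0 a s) = (s * r ^+ d.-1)%:E.
Proof.
move=> r0 s0; rewrite box_measure; last by move=> i; case: eqP; rewrite lerDl.
rewrite (bigD1 i0)//= eqxx addrAC subrr add0r; congr (_ * _)%:E.
rewrite (eq_bigr (fun=> r)).
  by rewrite prodr_const cardC1 card_ord.
by move=> i /negbTE ->; rewrite addrAC subrr add0r.
Qed.

Lemma bigsetU_measure_le n (F : 'I_n -> set 'rV[R]_d) (m : R) :
  (forall i, measurable (F i)) -> (forall i, lebesgue_rV (F i) <= m%:E)%E ->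
  (@lebesgue_rV R d (\big[setU/set0]_(i < n) F i) <= (n%:R * m)%:E)%E.
Proof.
elim: n F => [|n IH] F mF Fm; first by rewrite big_ord0 measure0 mul0r.
rewrite big_ord_recr/= (le_trans (measureU2 _ _ _))//.
  exact: bigsetU_measurable.
rewrite -natr1 mulrDl mul1r EFinD leeD//; last exact: Fm.
by apply: (IH (fun i => F (widen_ord (leqnSn n) i))) => i; [exact: mF|exact: Fm].
Qed.

End box_measure.

Lemma bernoulli (R : realFieldType) n (x : R) : -1 <= x -> 1 + n%:R * x <= (1 + x) ^+ n.
Proof.
move=> x1; elim: n => [|n IH]; first by rewrite mul0r addr0 expr0.
have x0 : 0 <= 1 + x by lra.
rewrite exprS -natr1 (le_trans _ (ler_wpM2l x0 IH))//.
have := mulr_ge0 (ler0n R n) (sqr_ge0 x); rewrite expr2; lra.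
Qed.

(* On the even cell the density exceeds 1 by an amount of order 1/b on half of the cell,
   on the odd one it equals 1 outside the thin stripes of the next stage. *)
Section cell_masses.
Variables (R : realType) (d : nat) (i1 i2 : 'I_d) (ell hh c : nat -> R).
Hypothesis i12 : i1 != i2.
Hypotheses (ell_gt0 : forall j, 0 < ell j) (ell_hh : forall j, 4 * ell j.+1 <= hh j).
Hypotheses (c_ge0 : forall j, 0 <= c j) (c_le : forall j, c j.+1 <= c j).
Hypothesis c_small : forall e, 0 < e -> exists n, c n < e.
Variables (j M k k2 : nat) (b : R) (q : 'rV[R]_d).
Let l := ell j.+1.
Let h := hh j.+1.
Let l2 := ell j.+2.
Hypotheses (lh : l = M%:R * h) (cb : c j = b^-1) (b1 : 1 <= b).
Hypothesis b_large : 8 * d%:R + 8 <= cos (pi / 4) * b.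
Hypothesis thin : M.+1%:R * (4 * l2) <= l / b ^+ 2.
Hypotheses (q1 : q 0 i1 = k.*2%:R * l) (q2 : q 0 i2 = k2%:R * h).
Hypothesis core : forall y, q 0 i2 <= y <= q 0 i2 + l ->
  forall m, (m <= j)%N -> stripe ell hh m y = 1.
Let rho (v : 'rV[R]_d) := wave_density ell hh c (v 0 i1) (v 0 i2).
Let e1 : 'rV[R]_d := delta_mx 0 i1.
(** Each slab contains the support, from [- l2] to [3 * l2], of one stripe of stage [j.+1]. There
    are [M.+1] of them since both ends of the cell are on the lattice of step [h]. *)
Let bad (p : 'rV[R]_d) r :=
  \big[setU/set0]_(s < M.+1) slab p r i2 (q 0 i2 + s%:R * h - l2) (4 * l2).

Let l_gt0 : 0 < l := ell_gt0 j.+1.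
Let l2_gt0 : 0 < l2 := ell_gt0 j.+2.
Let h_gt0 : 0 < h.
Proof. by rewrite (lt_le_trans _ (ell_hh j.+1))// mulr_gt0. Qed.
Let b_gt0 : 0 < b. Proof. exact: lt_le_trans b1. Qed.

Let measurable_bad p r : measurable (bad p r).
Proof. by apply: bigsetU_measurable => s _; exact: measurable_box. Qed.

Let bad_measure p r : 0 <= r -> r <= l -> (@lebesgue_rV R d (bad p r) <= (l ^+ d / b ^+ 2)%:E)%E.
Proof.
move=> r0 rl.
apply: (le_trans (bigsetU_measure_le (m := 4 * l2 * l ^+ d.-1) _ _)).
- by move=> s; exact: measurable_box.
- move=> s; rewrite slab_measure// ?mulr_ge0 ?(ltW l2_gt0)// lee_fin.
  rewrite ler_wpM2l ?mulr_ge0 ?(ltW l2_gt0)// lerXn2r// nnegrE//.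
  exact: ltW.
- have -> : l ^+ d = l * l ^+ d.-1.
    by rewrite -exprS prednK// (leq_ltn_trans (leq0n _) (ltn_ord i1)).
  by rewrite lee_fin mulrA [leRHS]mulrAC ler_wpM2r// exprn_ge0// ltW.
Qed.

Let stripe_good p r v : cube p r v -> q 0 i2 <= v 0 i2 <= q 0 i2 + l ->
  ~ bad p r v -> stripe ell hh j.+1 (v 0 i2) = 0.
Proof.
move=> pv vq nbad; pose t := v 0 i2 - q 0 i2.
have th0 : 0 <= t / h by rewrite divr_ge0 ?(ltW h_gt0)// subr_ge0; case/andP: vq.
pose s := Num.trunc (t / h); have /andP[s1 s2] := truncn_itv th0.
rewrite -/s in s1 s2; rewrite ler_pdivlMr// in s1; rewrite ltr_pdivrMr// in s2.
have nslab u : (u <= M)%N -> ~ slab p r i2 (q 0 i2 + u%:R * h - l2) (4 * l2) v.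
  move=> uM sv; apply: nbad; rewrite /bad -(bigcup_mkord _ (fun u =>
    slab p r i2 (q 0 i2 + u%:R * h - l2) (4 * l2))).
  by exists u.
have nint u : (u <= M)%N ->
    ~ (q 0 i2 + u%:R * h - l2 <= v 0 i2 <= q 0 i2 + u%:R * h - l2 + 4 * l2).
  move=> uM uv; apply: (nslab u uM) => i; case: eqP => [->//|_]; exact: pv.
have tl : t <= l by rewrite lerBlDl; case/andP: vq.
have sM : (s <= M)%N by rewrite -(ler_nat R) -(ler_pM2r h_gt0) -lh (le_trans s1).
have -> : v 0 i2 = (k2 + s)%:R * h + (t - s%:R * h).
  by rewrite natrD mulrDl -q2 /t; ring.
apply: stripe0 => //; rewrite -/l2 -/h.
have vE : v 0 i2 = q 0 i2 + t by rewrite /t addrC subrK.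
have n1 := nint s sM; rewrite vE in n1.
have t3 : s%:R * h + 3 * l2 < t.
  rewrite ltNge; apply/negP => t3; apply: n1; have := l2_gt0; lra.
apply/andP; split; first by lra.
have [sM'|sM'] := ltnP s M.
  have n2 := nint s.+1 sM'; rewrite vE in n2.
  rewrite leNgt; apply/negP => t4; apply: n2; rewrite -natr1 in s2 *.
  by have := l2_gt0; lra.
have : l <= s%:R * h by rewrite lh ler_pM2r// ler_nat.
have := l2_gt0; lra.
Qed.

Let rho_measurable (A : set 'rV[R]_d) : measurable_fun A (EFin \o rho).
Proof.
by apply: continuous_measurable_rV; exact: wave_density_continuous.
Qed.

Let odd_mass : (\int[@lebesgue_rV R d]_(v in cube (q + l *: e1) l) (rho v)%:E <=
  (l ^+ d * (1 + b ^- 3))%:E)%E.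
Proof.
set p := q + l *: e1.
have pq i : p 0 i = q 0 i + l * (i == i1)%:R by rewrite !mxE eqxx.
have mB := measurable_bad p l.
have v2 v : cube p l v -> q 0 i2 <= v 0 i2 <= q 0 i2 + l.
  by move=> /(_ i2); rewrite pq eq_sym (negbTE i12) mulr0 addr0.
have step : (\int[@lebesgue_rV R d]_(v in cube p l) (rho v)%:E <=
    @lebesgue_rV R d (cube p l) + (c j)%:E * @lebesgue_rV R d (bad p l `&` cube p l))%E.
  apply: integral_le_step => //; first exact: measurable_cube.
  - by move=> v _; rewrite (le_trans ler01)//; exact: wave_density_ge1.
  - by move=> v /v2 vq; apply: wave_density_core_le => //; exact: core.
  - move=> v pv nb.
    have -> : rho v = 1 + c j * wave ell j (v 0 i1).
      apply: wave_density_core => //; first exact: core (v2 _ pv).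
      exact: stripe_good pv (v2 _ pv) nb.
    rewrite (_ : v 0 i1 = k.*2.+1%:R * l + (v 0 i1 - p 0 i1)).
      rewrite wave_odd ?mulr0 ?addr0//.
      by have := pv i1; rewrite -/l; lra.
    by rewrite pq q1 eqxx mulr1 -natr1; ring.
apply: le_trans step _.
rewrite cube_measure ?(ltW l_gt0)// cb.
rewrite mulrDr mulr1 EFinD leeD2l//.
apply: le_trans (_ : (b^-1)%:E * (l ^+ d / b ^+ 2)%:E <= _)%E.
  rewrite lee_wpmul2l ?lee_fin ?invr_ge0 ?(ltW b_gt0)//.
  apply: le_trans (bad_measure p (ltW l_gt0) (lexx l)).
  by apply: le_measure; rewrite ?inE//; apply: measurableI => //; exact: measurable_cube.
by rewrite -EFinM lee_fin mulrCA -invfM -exprS.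
Qed.

Let eta := l / b ^+ 2.
Let p := q + const_mx eta : 'rV[R]_d.
Let r := l - 2 * eta.

Let b_ge8 : 8 <= b.
Proof.
have := b_large; have := cos_le1 (pi / 4 : R); have := ler0n R d; have := b_gt0; nra.
Qed.

Let ib := b^-1.
Let ib_gt0 : 0 < ib. Proof. by rewrite invr_gt0. Qed.
Let bib : b * ib = 1. Proof. by rewrite divff// gt_eqF. Qed.
Let ib_le : ib <= 8^-1. Proof. by rewrite lef_pV2 ?posrE. Qed.

Let rE : r = l * (1 - 2 * ib ^+ 2).
Proof. by rewrite /r /eta /ib -exprVn; ring. Qed.

Let r_ge : 3 / 4 * l <= r.
Proof.
by rewrite rE mulrC ler_pM2l//; have := ib_gt0; have := ib_le; rewrite expr2; nra.
Qed.

(** Shrinking costs at most the fraction [2 * d / b ^ 2] of the volume. The middle half of the cell,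
    without the bad slabs, still has a quarter of the volume and gains [cos (pi / 4) / b] there;
    [b_large] makes this exceed the cost plus [b ^- 3]. *)
Let even_mass : ((l ^+ d * (1 + b ^- 3))%:E <
  \int[@lebesgue_rV R d]_(v in cube p r) (rho v)%:E)%E.
Proof.
have pq i : p 0 i = q 0 i + eta by rewrite !mxE.
have r0 : 0 <= r by apply: le_trans r_ge; rewrite mulr_ge0// ltW.
have rl : r <= l by rewrite gerBl mulr_ge0// divr_ge0 ?sqr_ge0// ltW.
have v2 v : cube p r v -> q 0 i2 <= v 0 i2 <= q 0 i2 + l.
  move=> /(_ i2); rewrite pq.
  have : 0 <= eta by rewrite divr_ge0 ?sqr_ge0// ltW.
  rewrite /r; lra.
set D := slab p r i1 (q 0 i1 + l / 4) (l / 2).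
have Dp : D `<=` cube p r.
  move=> v Dv i; have := Dv i; case: eqP => [->|//].
  by rewrite pq; have := r_ge; have := l_gt0; rewrite /r; lra.
have mD : measurable D by exact: measurable_box.
have mG : measurable (D `\` bad p r) by exact: measurableD.
have c00 : 0 <= cos (pi / 4 : R).
  by rewrite cos_ge0_pihalf//; have := pi_gt0 R; lra.
have step : (@lebesgue_rV R d (cube p r) +
    (c j * cos (pi / 4))%:E * @lebesgue_rV R d ((D `\` bad p r) `&` cube p r) <=
    \int[@lebesgue_rV R d]_(v in cube p r) (rho v)%:E)%E.
  apply: integral_ge_step => //.
  - exact: measurable_cube.
  - by rewrite mulr_ge0.
  - by move=> v _; exact: wave_density_ge1.
  - move=> v pv [Dv nb].
    have -> : rho v = 1 + c j * wave ell j (v 0 i1).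
      apply: wave_density_core => //; first exact: core (v2 _ pv).
      exact: stripe_good pv (v2 _ pv) nb.
    rewrite lerD2l ler_wpM2l// (_ : v 0 i1 = k.*2%:R * l + (v 0 i1 - q 0 i1)).
      apply: wave_even => //.
      by have := Dv i1; rewrite eqxx -/l; lra.
    by rewrite q1; ring.
apply: lt_le_trans step.
rewrite setIidl; last by apply: subset_trans Dp; exact: subDsetl.
have DG : ((l / 2 * r ^+ d.-1 - l ^+ d / b ^+ 2)%:E <= @lebesgue_rV R d (D `\` bad p r))%E.
  rewrite EFinB leeBlDr// -(slab_measure p i1 (q 0 i1 + l / 4))//; last by rewrite divr_ge0// ltW.
  rewrite -/D (le_trans _ (leeD (le_refl _) (bad_measure p r0 rl)))//.
  apply: le_trans (measureU2 _ mG (measurable_bad p r)).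
  apply: le_measure; rewrite ?inE//; first exact: measurableU.
  by move=> v Dv; have [|] := pselect (bad p r v); [right|left].
rewrite cube_measure//.
apply: (@lt_le_trans _ _ ((r ^+ d)%:E + (c j * cos (pi / 4))%:E *
  (l / 2 * r ^+ d.-1 - l ^+ d / b ^+ 2)%:E)%E); last first.
  by rewrite leeD2l// lee_wpmul2l// lee_fin mulr_ge0.
rewrite -EFinM -EFinD lte_fin cb.
pose x := 1 - 2 * ib ^+ 2; have rx : r = l * x by exact: rE.
have x0 : 0 <= x by rewrite /x expr2; have := ib_gt0; have := ib_le; nra.
have x1 : x <= 1 by rewrite /x gerBl mulr_ge0// sqr_ge0.
have xd : 1 - 2 * d%:R * ib ^+ 2 <= x ^+ d.
  have := @bernoulli R d (- (2 * ib ^+ 2)); rewrite -/x.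
  have -> : 1 + d%:R * - (2 * ib ^+ 2) = 1 - 2 * d%:R * ib ^+ 2 by ring.
  by apply; rewrite lerN2 expr2; have := ib_gt0; have := ib_le; nra.
have lr : l * r ^+ d.-1 >= l ^+ d * x ^+ d.
  have d1 : d = d.-1.+1 by rewrite prednK// (leq_ltn_trans (leq0n _) (ltn_ord i1)).
  have -> : l ^+ d * x ^+ d = l * (l ^+ d.-1 * x ^+ d.-1) * x.
    by rewrite d1 !exprS /=; ring.
  by rewrite -exprMn -rx ler_piMr// mulr_ge0 ?exprn_ge0// ltW.
have ld : 0 < l ^+ d by rewrite exprn_gt0.
rewrite -exprVn -/ib.
rewrite rx exprMn -rx -exprVn -/ib.
apply: (@lt_le_trans _ _ (l ^+ d * (x ^+ d + ib * cos (pi / 4) * (x ^+ d / 2 - ib ^+ 2)))).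
  rewrite ltr_pM2l//.
  have bl := b_large; set c1 := cos (pi / 4) in c00 bl *.
  have c1ib : (8 * d%:R + 8) * ib ^+ 2 <= c1 * ib.
    have -> : c1 * ib = c1 * b * ib ^+ 2 by rewrite expr2 mulrA -(mulrA c1) bib mulr1.
    by rewrite ler_wpM2r ?sqr_ge0.
  have c11 : c1 <= 1 by exact: cos_le1.
  have dib : 8 * d%:R * ib ^+ 2 <= ib.
    apply: le_trans (_ : c1 * ib <= _); last by rewrite ler_piMl// ltW.
    by apply: le_trans c1ib; rewrite ler_wpM2r ?sqr_ge0// lerDl.
  have xh : 4^-1 <= x ^+ d / 2 - ib ^+ 2.
    have := ib_gt0; have := ib_le; rewrite expr2 in dib xd *; nra.
  have h1 : c1 * ib / 4 <= ib * c1 * (x ^+ d / 2 - ib ^+ 2).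
    by rewrite (mulrC ib) ler_wpM2l// mulr_ge0// ltW.
  have h2 : ib ^+ 3 <= ib ^+ 2 by rewrite ler_wiXn2l//; have := ib_gt0; have := ib_le; lra.
  have h3 : 0 < ib ^+ 2 by rewrite exprn_gt0.
  lra.
rewrite mulrDr lerD2l.
have h4 : l ^+ d * (x ^+ d / 2 - ib ^+ 2) <= l / 2 * r ^+ d.-1 - l ^+ d * ib ^+ 2 by lra.
by rewrite mulrCA ler_wpM2l// mulr_ge0// ltW.
Qed.

Lemma cell_mass_lt :
  (\int[@lebesgue_rV R d]_(v in cube (q + l *: e1) l) (rho v)%:E <
   \int[@lebesgue_rV R d]_(v in cube p r) (rho v)%:E)%E.
Proof. exact: le_lt_trans odd_mass even_mass. Qed.

End cell_masses.

(** * The stretching step *)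

Section stretching.
Variables (R : realType) (d : nat) (i1 : 'I_d) (f : 'rV[R]_d -> 'rV[R]_d).
Variables (b n : nat) (h A : R) (p : 'rV[R]_d).
Let br : R := b%:R.
(** The [6 * d] accounts for the roughly [b ^ (6 * d)] grid nodes of a cell that one index has to
    serve. Of the remaining [14], twelve give the precision [(l / b ^ 5) ^ 2], which is [b ^- 12]
    times [(b * l) ^ 2], and two absorb constants. *)
Let m := (6 * d + 14)%N.
Let l := br ^+ 6 * h.
Let ell := n.*2%:R * l.
Let k := br ^- m.
Let eta := l / br ^+ 2.
Let e1 : 'rV[R]_d := delta_mx 0 i1.
Hypotheses (h0 : 0 < h) (A0 : 0 < A) (Ab : A <= br) (nb : n.*2 = (b ^ m)%N).
Hypotheses (b_large : (2 ^ d.+3 * (8 * d + 2) <= b)%N) (b12 : (12 <= b)%N).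
Hypothesis fc : continuous f.
Hypothesis f1 : forall x y, unit_cube d x -> unit_cube d y -> `|x - y| <= l ->
  `|f x - f y| <= br * (`|x - y| + h).
Hypothesis f2 : forall x y, unit_cube d x -> unit_cube d y -> `|x - y| <= l ->
  `|x - y| <= br * (`|f x - f y| + h).
Hypothesis p_in : forall i, 0 <= p 0 i /\ p 0 i + 2 * ell <= 1.
Hypothesis p_stretch : A * ell <= norm2 (f (p + ell *: e1) - f p).
Hypothesis no_match : forall i, (i < n)%N -> forall w,
  ~ (forall x, cube (p + (i.*2%:R * l) *: e1 + const_mx eta) (l - 2 * eta) x ->
    (f @` cube (p + (i.*2%:R * l) *: e1 + l *: e1) l) (f x + w)).

(** The offsets run through a grid of mesh [h] on a cell of side [l = b ^ 6 * h]; each one gives a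
    path of [n.*2] steps parallel to [e1]. *)
Let offset (s : {ffun 'I_d -> 'I_(b ^ 6).+1}) : 'rV[R]_d := \row_i (h * (s i)%:R).
Let node i s := p + (i%:R * l) *: e1 + offset s.

Let br12 : 12 <= br. Proof. by rewrite ler_nat. Qed.
Let br0 : 0 < br. Proof. by apply: lt_le_trans br12. Qed.
Let b1 : 1 <= br. Proof. by apply: le_trans br12; rewrite ler1n. Qed.
Let h_le_l : h <= l. Proof. by rewrite ler_peMl ?exprn_ege1// ltW. Qed.
Let l0 : 0 < l. Proof. by rewrite mulr_gt0 ?exprn_gt0. Qed.
Let n0 : (0 < n)%N.
Proof. by rewrite -double_gt0 nb expn_gt0 (leq_trans _ b12). Qed.
Let d0 : (0 < d)%N. Proof. exact: leq_ltn_trans (leq0n _) (ltn_ord i1). Qed.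

Let le_ell i : (i <= n.*2)%N -> i%:R * l <= ell.
Proof. by move=> iN; rewrite ler_pM2r// ler_nat. Qed.

Let l_ell : l <= ell.
Proof. by rewrite -[leLHS]mul1r ler_pM2r// ler1n double_gt0. Qed.

Let cell_in i x : (i <= n.*2)%N -> cube (p + (i%:R * l) *: e1) l x -> unit_cube d x.
Proof.
move=> iN px j; have := px j; have [pj0 pj1] := p_in j.
have := le_ell iN; have : 0 <= i%:R * l by rewrite mulr_ge0// ltW.
have := l_ell; rewrite !mxE eqxx /=; case: (j == i1) => /=; rewrite ?mulr1 ?mulr0; lra.
Qed.

Let offset_le s j : 0 <= offset s 0 j <= l.
Proof.
rewrite mxE mulr_ge0 ?(ltW h0)//= /l mulrC ler_pM2r// -natrX ler_nat -ltnS.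
exact: ltn_ord.
Qed.

Let node_cell i s : cube (p + (i%:R * l) *: e1) l (node i s).
Proof. by move=> j; rewrite /node [(_ + offset s) 0 j]mxE; have := offset_le s j; lra. Qed.

Let nodeS i s : node i.+1 s = node i s + l *: e1.
Proof. by rewrite /node -(natr1 i) mulrDl mul1r scalerDl addrA [RHS]addrAC. Qed.

Let near_node i x : cube (p + (i%:R * l) *: e1) l x -> exists s, `|x - node i s| <= h.
Proof.
move=> px; set q := p + _ in px.
have q0 j : 0 <= (x 0 j - q 0 j) / h.
  by rewrite divr_ge0 ?(ltW h0)// subr_ge0; have /andP[] := px j.
have sP (j : 'I_d) : (Num.trunc ((x 0 j - q 0 j) / h)%R < (b ^ 6).+1)%N.
  rewrite ltnS truncn_le_nat ltr_pdivrMr//; apply: (@le_lt_trans _ _ l).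
    by rewrite lerBlDl; have /andP[] := px j.
  by rewrite ltr_pM2r// -natrX ltr_nat.
exists [ffun j => Ordinal (sP j)]; apply: norm_rV_le => [|j]; first exact: ltW.
have /andP[] := truncn_itv (q0 j); rewrite ler_pdivlMr// ltr_pdivrMr// -natr1.
set t := Num.trunc _ => t1 t2.
have -> : (x - node i [ffun j => Ordinal (sP j)]) 0 j = x 0 j - (q 0 j + h * t%:R).
  by rewrite /node /offset !mxE ffunE.
rewrite ler_norml; move: t1 t2; lra.
Qed.

Let W := f (p + ell *: e1) - f p.
Let w i s := f (node i.+1 s) - f (node i s).

Let sum_w s : `|\sum_(i < n.*2) w i s - W| <= 4 * br * l.
Proof.
have -> : \sum_(i < n.*2) w i s = f (node n.*2 s) - f (node 0 s).
  by rewrite -(telescope_sumr (fun i => f (node i s)))// big_mkord.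
have hl := h_le_l.
have offset_norm t : `|offset t| <= l.
  apply: norm_rV_le => [|j]; first exact: ltW.
  by have := offset_le t j; rewrite ler_norml; have := l0; lra.
have near i (t : 'rV[R]_d) : (i <= n.*2)%N -> t = p + (i%:R * l) *: e1 ->
    `|f (node i s) - f t| <= 2 * br * l.
  move=> iN tE; have ns : `|node i s - t| <= l.
    by rewrite tE /node addrAC subrr add0r.
  apply: (@le_trans _ _ (br * (`|node i s - t| + h))).
    apply: f1 => //; first exact: cell_in iN (node_cell i s).
    apply: (cell_in iN) => j; rewrite tE lexx/=.
    by rewrite lerDl ltW.
  rewrite (mulrC 2) -mulrA ler_pM2l//; lra.
have -> : f (node n.*2 s) - f (node 0 s) - W =
    (f (node n.*2 s) - f (p + ell *: e1)) - (f (node 0 s) - f p).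
  rewrite /W; move: (f _) (f _) (f _) (f _) => u v y z.
  by apply/rowP => j; rewrite !mxE; ring.
rewrite (le_trans (ler_normB _ _))// (le_trans (lerD (near _ _ (leqnn _) erefl) (near 0%N p _ _)))//.
  by rewrite mul0r scale0r addr0.
by rewrite -mulrDl -mulrDl -natrD.
Qed.

(** With [A <= b] and [1 / n = 2 * k], all terms are at most constants times
    [#|I| * k * (b * l) ^ 2], and [#|I| * k <= 2 ^ d * b ^- 14]. *)
Let increment_bound : k ^+ 2 * (A * l) ^+ 2 + 2 * (#|{ffun 'I_d -> 'I_(b ^ 6).+1}|%:R *
  (2 * k * (A * l) ^+ 2 + d%:R * (4 * br * l) * (A * l) / n%:R)) <= (l / br ^+ 5) ^+ 2.
Proof.
have nR : n%:R = (2 * k)^-1 :> R.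
  apply: (mulfI (x := 2)) => //; rewrite -natrM mul2n nb natrX -/br /k.
  by field; rewrite expf_neq0// gt_eqF.
set I := #|_|%:R; have I1 : 1 <= I.
  by rewrite ler1n card_ffun !card_ord expn_gt0.
have I_le : I <= 2 ^+ d * (br ^+ 6) ^+ d.
  rewrite -exprMn -natrX -(natrM _ 2) -natrX ler_nat card_ffun !card_ord.
  case: (d) => // d'; rewrite leq_exp2r// mul2n -addnn -addn1 leq_add2l expn_gt0.
  by rewrite (leq_trans _ b12).
have k0 : 0 < k by rewrite invr_gt0 exprn_gt0.
have k1 : k <= 1 by rewrite invf_le1 ?exprn_gt0// exprn_ege1.
have Al : A * l <= br * l by rewrite ler_pM2r.
have Al0 : 0 < A * l by rewrite mulr_gt0.
have Al2 : (A * l) ^+ 2 <= (br * l) ^+ 2 by rewrite lerXn2r// nnegrE ltW// mulr_gt0.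
have brl0 : 0 < br * l by rewrite mulr_gt0.
have step1 : 2 * k * (A * l) ^+ 2 + d%:R * (4 * br * l) * (A * l) / n%:R <=
    (2 + 8 * d%:R) * k * (br * l) ^+ 2.
  have -> : (2 + 8 * d%:R) * k * (br * l) ^+ 2 = 2 * k * (br * l) ^+ 2 +
    d%:R * (4 * br * l) * (br * l) * (2 * k) by ring.
  rewrite nR invrK lerD//; first by rewrite ler_pM2l// mulr_gt0.
  have dl : 0 <= d%:R * (4 * br * l) by rewrite !mulr_ge0// ltW.
  by rewrite ler_wpM2r ?mulr_ge0 ?(ltW k0)// ler_wpM2l.
have step2 : k ^+ 2 * (A * l) ^+ 2 <= 2 * I * k * (br * l) ^+ 2.
  apply: ler_pM; rewrite ?sqr_ge0// expr2 ler_pM2r//.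
  by move: k1 I1; lra.
have step3 : I * k * br ^+ 12 <= 2 ^+ d * br^-1.
  apply: (@le_trans _ _ (2 ^+ d * (br ^+ 6) ^+ d * k * br ^+ 12)).
    by rewrite ler_pM2r ?exprn_gt0// ler_pM2r.
  have -> : 2 ^+ d * (br ^+ 6) ^+ d * k * br ^+ 12 = 2 ^+ d * br ^- 2.
    have bn : br != 0 by rewrite gt_eqF.
    rewrite /k /m exprD exprM -exprM; field.
    by rewrite bn expf_neq0.
  rewrite ler_pM2l ?exprn_gt0// lef_pV2 ?posrE ?exprn_gt0//.
  by rewrite expr2 ler_peMl// ltW.
have step4 : 2 ^+ d * (6 + 16 * d%:R) <= br.
  apply: (@le_trans _ _ (2 ^ d.+3 * (8 * d + 2))%:R); last by rewrite ler_nat.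
  rewrite natrM natrX natrD natrM !exprS.
  have d1 : 0 <= d%:R :> R by [].
  rewrite (_ : 2 * (2 * (2 * 2 ^+ d)) * (8 * d%:R + 2) = 2 ^+ d * (64 * d%:R + 16)); last by ring.
  by rewrite ler_pM2l ?exprn_gt0//; lra.
apply: (@le_trans _ _ ((6 + 16 * d%:R) * (I * k) * (br * l) ^+ 2)).
  rewrite (_ : (6 + 16 * d%:R) * (I * k) * (br * l) ^+ 2 = 2 * I * k * (br * l) ^+ 2 +
    2 * (I * ((2 + 8 * d%:R) * k * (br * l) ^+ 2))); last by ring.
  rewrite lerD// ler_pM2l// ler_pM2l//; exact: lt_le_trans I1.
have -> : (l / br ^+ 5) ^+ 2 = br ^- 12 * (br * l) ^+ 2.
  by field; rewrite gt_eqF.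
rewrite ler_pM2r ?exprn_gt0// -[leRHS]mul1r ler_pdivlMr ?exprn_gt0//.
have c0 : 0 < 6 + 16 * d%:R :> R by rewrite ltr_pwDl// mulr_ge0.
rewrite -mulrA (le_trans (ler_wpM2l (ltW c0) step3))//.
by rewrite mulrA ler_pdivrMr// mul1r mulrC.
Qed.

Lemma longer_increment : exists i s, (i < n.*2)%N /\
  (1 + k) * A * l <= norm2 (f (node i s + l *: e1) - f (node i s)).
Proof.
apply: contrapT => nex.
have short i s : (i < n.*2)%N -> norm2 (w i s) <= (1 + k) * (A * l).
  move=> iN; rewrite leNgt; apply/negP => lw; apply: nex; exists i, s; split => //.
  by rewrite -nodeS -mulrA ltW.
have Al0 : 0 < A * l by rewrite mulr_gt0.
have k0 : 0 <= k by rewrite invr_ge0 exprn_ge0// ltW.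
have err0 : 0 <= 4 * br * l by rewrite !mulr_ge0// ltW.
have len : n.*2%:R * (A * l) <= norm2 W.
  by apply: le_trans p_stretch; rewrite mulrCA.
have [v [i iN wv]] := almost_equal_increments n0 Al0 k0 err0 short sum_w len.
have {}wv s : `|w i.*2 s - v| <= l / br ^+ 5.
  apply: le_trans (norm_le_norm2 _) _.
  rewrite -(ler_pXn2r (n := 2))// ?nnegrE ?norm2_ge0//.
    exact: le_trans (wv s) increment_bound.
  by rewrite divr_ge0 ?exprn_ge0// ltW.
have i2 : (i.*2 <= n.*2)%N by rewrite leq_double ltnW.
have i2' : (i.*2.+1 <= n.*2)%N by rewrite ltn_double.
(* At all nodes of cell [i.*2] the increment is within [l / b ^ 5 = b * h] of the same [v]. Hence
   [f x + v] is close to [f (x + l *: e1)] on the whole cell, and invariance of domain puts it into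
   the image of the next cell. *)
apply: (no_match iN (w := v)) => x xin.
have x_cell : cube (p + (i.*2%:R * l) *: e1) l x.
  move=> j; have := xin j; rewrite [(_ + const_mx _) 0 j]mxE [const_mx _ _ _]mxE.
  have : 0 <= eta by rewrite divr_ge0 ?exprn_ge0// ltW.
  lra.
have shiftE : p + (i.*2%:R * l) *: e1 + l *: e1 = p + (i.*2.+1%:R * l) *: e1.
  by rewrite -(natr1 i.*2) mulrDl mul1r scalerDl addrA.
rewrite shiftE.
have y_cell : cube (p + (i.*2.+1%:R * l) *: e1) l (x + l *: e1).
  by move=> j; rewrite -shiftE [(_ + l *: e1) 0 j]mxE [(x + _) 0 j]mxE; have := x_cell j; lra.
have [s xs] := near_node x_cell.
have close (y z : 'rV[R]_d) : unit_cube d y -> unit_cube d z -> `|y - z| <= h -> `|f y - f z| <= 2 * br * h.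
  move=> yQ zQ yz; apply: (@le_trans _ _ (br * (`|y - z| + h))).
    apply: f1 => //; apply: le_trans yz _.
    exact: h_le_l.
  rewrite (mulrC 2) -mulrA ler_pM2l//; lra.
(* Two grid errors [2 * b * h] and the deviation [b * h] from [v]. *)
have delta : `|f x + v - f (x + l *: e1)| <= 5 * l / br ^+ 5.
  have -> : f x + v - f (x + l *: e1) = (f x - f (node i.*2 s)) -
    (f (x + l *: e1) - f (node i.*2.+1 s)) - (w i.*2 s - v).
    by rewrite /w; apply/rowP => j; rewrite !mxE; ring.
  rewrite (le_trans (ler_normB _ _))// (le_trans (lerD (ler_normB _ _) (wv s)))//.
  have c1 := close _ _ (cell_in i2 x_cell) (cell_in i2 (node_cell _ s)) xs.
  have c2 : `|f (x + l *: e1) - f (node i.*2.+1 s)| <= 2 * br * h.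
    apply: close; first exact: cell_in i2' y_cell.
      exact: cell_in i2' (node_cell _ s).
    by rewrite nodeS opprD addrACA subrr addr0.
  have -> : 5 * l / br ^+ 5 = 4 * (br * h) + l / br ^+ 5.
    by rewrite /l; field; rewrite gt_eqF.
  lra.
have delta0 : 0 < 5 * l / br ^+ 5 by rewrite divr_gt0 ?mulr_gt0 ?exprn_gt0.
apply: (quantitative_open_image d0 l0 b1 h0 delta0 _ _ _ _ delta).
- by move=> z _; exact: fc.
- move=> z z' zc zc'; apply: f1; [exact: cell_in zc|exact: cell_in zc'|].
  by apply: cube_dist zc zc'; exact: ltW.
- move=> z z' zc zc'; apply: f2; [exact: cell_in zc|exact: cell_in zc'|].
  by apply: cube_dist zc zc'; exact: ltW.
- move=> j; rewrite -shiftE [(_ + l *: e1) 0 j]mxE [(x + _) 0 j]mxE.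
  have := xin j; rewrite [(_ + const_mx _) 0 j]mxE [const_mx _ _ _]mxE.
  (* The shrunk cell provides the depth [eta = b ^ 4 * h], so [b ^ 2 >= 10 * b + 20] is needed;
     hence the bound [12 <= b]. *)
  suff : 10 * br ^+ 3 * h + 4 * br * (5 * l / br ^+ 5) <= eta by lra.
  have -> : 10 * br ^+ 3 * h + 4 * br * (5 * l / br ^+ 5) = (10 * br ^+ 3 + 20 * br ^+ 2) * h.
    by rewrite /l; field; rewrite gt_eqF.
  have -> : eta = br ^+ 4 * h by rewrite /eta /l; field; rewrite gt_eqF.
  rewrite ler_pM2r//.
  have -> : br ^+ 4 = br * br * br ^+ 2 by ring.
  have -> : 10 * br ^+ 3 + 20 * br ^+ 2 = (10 * br + 20) * br ^+ 2 by ring.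
  rewrite ler_pM2r ?exprn_gt0//; have := br12; nra.
Qed.

End stretching.

(** * Choice of the scales *)

Section scales.
Variables (R : realType) (d : nat).
Let m := (6 * d + 14)%N.
Let E := m.+2.

(* base is constant on blocks of more than b^E = b^(m+2) stages: a stretch growing by the factor
   1 + b^-m at each stage of a block grows by more than b^2, while it has to stay between
   1/b and b. *)
Definition base j := (2 ^ trunc_log (2 ^ E) (j + 2 ^ E))%N.

(** A cell splits into [b ^ m] cells of the next stage, the even number [n.*2] of the stretching
    step. The initial side [1 / 4] keeps a doubled cell at the origin inside the unit cube and
    [ln (1 / grid_size j)] above [1]. *)
Fixpoint cell_size j : R :=
  if j is j'.+1 then cell_size j' / (base j')%:R ^+ m else 4^-1.

Definition grid_size j : R := cell_size j / (base j)%:R ^+ 6.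

Definition amplitude j : R := (base j)%:R^-1.

Let E2 : (1 < 2 ^ E)%N. Proof. by rewrite -{1}(expn0 2) ltn_exp2l. Qed.

(** This is the purpose of the shift by [2 ^ E] in [base]. *)
Lemma base_ge2 j : (2 <= base j)%N.
Proof.
rewrite /base -{1}(expn1 2) leq_exp2l//; apply: trunc_log_max => //.
by rewrite expn1 leq_addl.
Qed.

Lemma base_le i j : (i <= j)%N -> (base i <= base j)%N.
Proof. by move=> ij; rewrite /base leq_exp2l// leq_trunc_log// leq_add2r. Qed.

(** For [B = (2 ^ T) ^ E] the shifted window stays below [2 ^ E * B], since
    [2 * B + 1 + 2 ^ E <= 3 * B + 1 < 8 * B]. *)
Lemma base_block T j : (0 < T)%N -> ((2 ^ T) ^ E <= j <= 2 * (2 ^ T) ^ E + 1)%N ->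
  base j = (2 ^ T)%N.
Proof.
move=> T0 /andP[j1 j2]; congr (2 ^ _)%N; apply: trunc_log_eq => //.
have BE : ((2 ^ E) ^ T = (2 ^ T) ^ E)%N by rewrite -!expnM mulnC.
rewrite expnS BE (leq_trans j1 (leq_addr _ _))/=.
set B := ((2 ^ T) ^ E)%N in j1 j2 *; set F := (2 ^ E)%N.
have FB : (F <= B)%N.
  by rewrite /F /B leq_exp2r//; exact: (@leq_pexp2l 2 1 T).
have F4 : (8 <= F)%N by rewrite /F (_ : 8 = 2 ^ 3)%N// leq_exp2l// /E /m; lia.
apply: (@leq_ltn_trans (2 * B + 1 + B)); first by rewrite leq_add.
apply: (@leq_trans (8 * B)); last by rewrite leq_mul2r F4 orbT.
by have : (8 <= B)%N := leq_trans F4 FB; lia.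
Qed.

Let base0 j : 0 < (base j)%:R :> R.
Proof. by rewrite ltr0n (leq_trans _ (base_ge2 j)). Qed.

Lemma cell_size_gt0 j : 0 < cell_size j.
Proof. by elim: j => [|j IH] /=; rewrite ?invr_gt0// divr_gt0// exprn_gt0. Qed.

Lemma grid_size_gt0 j : 0 < grid_size j.
Proof. by rewrite divr_gt0 ?cell_size_gt0// exprn_gt0. Qed.

Lemma cell_grid j : 4 * cell_size j.+1 <= grid_size j.
Proof.
rewrite /= /grid_size; have b2 : 2 <= (base j)%:R :> R by rewrite ler_nat base_ge2.
have b1 : 1 <= (base j)%:R :> R by rewrite (le_trans _ b2)// ler1n.
rewrite mulrCA ler_pM2l ?cell_size_gt0// ler_pdivrMr ?exprn_gt0//.
have -> : m = (6 + (2 + (m - 8)))%N by rewrite /m; lia.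
rewrite exprD mulKf ?expf_neq0 ?gt_eqF// exprD.
rewrite -[leLHS]mulr1 ler_pM// ?exprn_ege1//.
have -> : 4 = 2 ^+ 2 :> R by ring.
by rewrite lerXn2r// nnegrE ltW.
Qed.

Lemma amplitude_ge0 j : 0 <= amplitude j.
Proof. by rewrite invr_ge0. Qed.

Lemma amplitude_le j : amplitude j.+1 <= amplitude j.
Proof. by rewrite lef_pV2 ?posrE// ler_nat base_le. Qed.

Lemma amplitude_small e : 0 < e -> exists n, amplitude n < e.
Proof.
move=> e0; pose T := (Num.trunc e^-1).+1.
exists ((2 ^ T) ^ E)%N; rewrite /amplitude (@base_block T)//; last first.
  by rewrite leqnn mul2n -addnn -addnA leq_addr.
rewrite invf_plt ?posrE// ?ltr0n ?expn_gt0// (lt_trans (truncnS_gt _))//.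
by rewrite ltr_nat ltn_expl.
Qed.

Lemma cell_size_anti i j : (i <= j)%N -> cell_size j <= cell_size i.
Proof.
move=> /subnK <-; elim: (j - i)%N => // n IH; rewrite addSn /=.
rewrite (le_trans _ IH)// ler_piMr ?(ltW (cell_size_gt0 _))//.
rewrite -exprVn exprn_ile1 ?invr_ge0// invf_le1// ler1n.
by rewrite (leq_trans _ (base_ge2 _)).
Qed.

Lemma cell_size_le j : cell_size j <= 4^-1.
Proof. exact: (cell_size_anti (leq0n j)). Qed.

Lemma cell_size_le2 j : cell_size j <= 2^-1 ^+ j.
Proof.
elim: j => [|j IH] /=; first by rewrite expr0; lra.
rewrite exprSr ler_pM ?invr_ge0 ?exprn_ge0 ?(ltW (cell_size_gt0 _))//.
rewrite lef_pV2 ?posrE ?exprn_gt0// (@le_trans _ _ (base j)%:R)//.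
  by rewrite ler_nat base_ge2.
rewrite -{1}[(base j)%:R]expr1; apply: ler_weXn2l; last by rewrite /m; lia.
by rewrite ler1n (leq_trans _ (base_ge2 j)).
Qed.

Lemma grid_size_le j : grid_size j <= cell_size j.
Proof.
rewrite /grid_size ler_piMr ?(ltW (cell_size_gt0 _))//.
rewrite -exprVn exprn_ile1 ?invr_ge0// invf_le1// ler1n.
by rewrite (leq_trans _ (base_ge2 j)).
Qed.

Lemma cell_size_ge b j : (base j <= b)%N -> (4 * b%:R ^+ (m * j))^-1 <= cell_size j.
Proof.
elim: j => [|j IH] bj; first by rewrite muln0 expr0 mulr1.
have bj' : (base j <= b)%N by rewrite (leq_trans (base_le (leqnSn j))).
have b0 : 0 < b%:R :> R by rewrite ltr0n (leq_trans _ bj)// ltnW// base_ge2.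
rewrite mulnS addnC exprD mulrA invfM /= ler_pM ?IH// ?invr_ge0 ?mulr_ge0 ?exprn_ge0//.
by rewrite lef_pV2 ?posrE ?exprn_gt0// lerXn2r ?nnegrE ?ler_nat// ltW.
Qed.

Lemma ln_ge_subV (x : R) : 0 < x -> 1 - x^-1 <= ln x.
Proof.
move=> x0; have := @le_ln1Dx R (x^-1 - 1); rewrite [1 + _]addrC subrK lnV//.
have : 0 < x^-1 by rewrite invr_gt0.
move=> xV0 h; have /h : -1 < x^-1 - 1 by lra.
by lra.
Qed.

Lemma ln_le_sub1 (x : R) : 0 < x -> ln x <= x - 1.
Proof.
by move=> x0; have := @le_ln1Dx R (x - 1); rewrite [1 + _]addrC subrK; apply; lra.
Qed.

Lemma ln4_ge1 : 1 <= ln (4 : R).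
Proof.
rewrite (_ : 4 = 2 * 2 :> R); last by ring.
by rewrite lnM ?posrE//; have := @ln_ge_subV 2 (ltr0Sn _ 1); lra.
Qed.

Lemma ln_grid_ge1 j : 1 <= ln (1 / grid_size j).
Proof.
have g4 : grid_size j <= 4^-1 := le_trans (grid_size_le j) (cell_size_le j).
apply: le_trans ln4_ge1 _; rewrite div1r ler_ln ?posrE ?invr_gt0 ?grid_size_gt0//.
by rewrite -[leLHS]invrK lef_pV2 ?posrE ?invr_gt0 ?grid_size_gt0.
Qed.

(** The logarithm is at most [(m * j + 8) * ln b]: two of the eight factors [b] absorb the [4] of
    the initial side, six come from the grid. Then [ln b <= b] and [j <= 2 * b ^ E + 1]. *)
Lemma ln_grid_le T j : (0 < T)%N -> ((2 ^ T) ^ E <= j <= 2 * (2 ^ T) ^ E + 1)%N ->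
  ln (1 / grid_size j) <= (3 * m + 8)%:R * (2 ^ T)%:R ^+ E.+1.
Proof.
move=> T0 jT; have bj := base_block T0 jT; set b := (2 ^ T)%N in bj jT *.
have b2 : (2 <= b)%N by rewrite -bj base_ge2.
have b0 : 0 < b%:R :> R by rewrite ltr0n (leq_trans _ b2).
apply: (@le_trans _ _ (ln (b%:R ^+ (m * j + 8)))).
  rewrite div1r ler_ln ?posrE ?exprn_gt0 ?invr_gt0 ?grid_size_gt0//.
  rewrite /grid_size bj invfM invrK.
  have := @cell_size_ge b j; rewrite bj leqnn => /(_ isT) h.
  have h2 : (cell_size j)^-1 <= 4 * b%:R ^+ (m * j).
    by rewrite -[leRHS]invrK lef_pV2// posrE ?invr_gt0 ?cell_size_gt0 ?mulr_gt0 ?exprn_gt0.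
  rewrite (_ : (m * j + 8 = 2 + m * j + 6)%N); last by lia.
  rewrite exprD ler_pM2r ?exprn_gt0// exprD (le_trans h2)// ler_pM2r ?exprn_gt0//.
  have -> : 4 = 2 ^+ 2 :> R by ring.
  by apply: lerXn2r; rewrite ?nnegrE ?(ltW b0) ?ler_nat.
rewrite lnXn// -[ln _ *+ _]mulr_natl.
apply: (@le_trans _ _ ((m * j + 8)%:R * b%:R)).
  by rewrite ler_wpM2l// (le_trans (ln_le_sub1 b0))// gerBl.
rewrite exprSr mulrA ler_pM2r// -natrX -natrM ler_nat.
have /andP[_ j2] := jT.
have : (1 <= b ^ E)%N by rewrite expn_gt0 (leq_trans _ b2).
move: j2; set B := (b ^ E)%N; nia.
Qed.

End scales.

(** * Iteration of the stretching step *)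

Section iteration.
Variables (R : realType) (d : nat) (i1 i2 : 'I_d) (f : 'rV[R]_d -> 'rV[R]_d) (T b : nat).
Variable a : R.
Let m := (6 * d + 14)%N.
Let E := m.+2.
Let br : R := b%:R.
Let e1 : 'rV[R]_d := delta_mx 0 i1.
Let ell := @cell_size R d.
Let hh := @grid_size R d.
Let amp := @amplitude R d.
Let rho (v : 'rV[R]_d) := wave_density ell hh amp (v 0 i1) (v 0 i2).
Let k := br ^- m.
Hypotheses (i12 : i1 != i2) (T0 : (0 < T)%N) (bT : b = (2 ^ T)%N) (b12 : (12 <= b)%N) (a0 : 0 < a).
Hypothesis b_large : (2 ^ d.+3 * (8 * d + 2) <= b)%N.
Hypothesis b_cos : 8 * d%:R + 8 <= cos (pi / 4) * br.
Hypothesis b_a : 2 * d%:R <= a * br.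
Hypotheses (fc : continuous f) (finj : set_inj (unit_cube d) f).
Hypothesis fpush : pushforward_equation rho f.
(** The [d] in the constant pays for passing between [norm2] and the sup norm, the [2] for the
    additional summand [hh j]. *)
Hypothesis F1 : forall j, (b ^ E <= j <= 2 * b ^ E + 1)%N ->
  forall x y, unit_cube d x -> unit_cube d y -> norm2 (x - y) < a ->
  norm2 (f x - f y) <= br / (2 * d%:R) * (hh j + norm2 (x - y)).
Hypothesis F2 : forall j, (b ^ E <= j <= 2 * b ^ E + 1)%N ->
  forall x y, unit_cube d x -> unit_cube d y -> norm2 (f x - f y) < a ->
  norm2 (x - y) <= br / (2 * d%:R) * (hh j + norm2 (f x - f y)).

Let d0 : 0 < d%:R :> R.
Proof. by rewrite ltr0n (leq_ltn_trans (leq0n _) (ltn_ord i1)). Qed.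
Let d1 : 1 <= d%:R :> R.
Proof. by rewrite ler1n (leq_ltn_trans (leq0n _) (ltn_ord i1)). Qed.
Let br12 : 12 <= br. Proof. by rewrite ler_nat. Qed.
Let br0 : 0 < br. Proof. by apply: lt_le_trans br12. Qed.
Let br1 : 1 <= br. Proof. by apply: le_trans br12; rewrite ler1n. Qed.
Let ell0 j : 0 < ell j. Proof. exact: cell_size_gt0. Qed.
Let hh0 j : 0 < hh j. Proof. exact: grid_size_gt0. Qed.

Let m_ge c : (c <= 14)%N -> (c <= m)%N.
Proof. by move=> c14; rewrite /m (leq_trans c14) ?leq_addl. Qed.

Let e1_norm (t : R) : 0 <= t -> norm2 (t *: e1) = t.
Proof.
move=> t0; rewrite norm2Z ger0_norm// /norm2 (bigD1 i1)//= big1 => [|i /negbTE ii].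
  by rewrite mxE !eqxx expr1n addr0 sqrtr1 mulr1.
by rewrite mxE ii andbF expr0n.
Qed.

(** The lattice conditions align the segment at [p] with the cells of the wave in direction [i1] and
    with the stripe of stage [j] in direction [i2]. The factor [2] leaves room for displaced and
    neighbouring cells of the next stage. *)
Definition admissible j (p : 'rV[R]_d) :=
  [/\ exists u : nat, p 0 i1 = u%:R * hh j,
      exists u : nat, p 0 i2 = u%:R * hh j,
      forall i, 0 <= p 0 i /\ p 0 i + 2 * ell j <= 1 &
      forall y, p 0 i2 <= y <= p 0 i2 + ell j ->
        forall n, (n < j)%N -> stripe ell hh n y = 1].

Section block.
Variable j : nat.
Hypothesis jb : (b ^ E <= j <= 2 * b ^ E)%N.

Let jb0 : (b ^ E <= j <= 2 * b ^ E + 1)%N.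
Proof. by case/andP: jb => -> /leq_trans; apply; rewrite leq_addr. Qed.
Let jb1 : (b ^ E <= j.+1 <= 2 * b ^ E + 1)%N.
Proof. by case/andP: jb => /leqW -> ?; rewrite addn1 ltnS. Qed.

Let base_j : base d j = b. Proof. by rewrite bT; apply: base_block; rewrite -?bT. Qed.
Let base_j1 : base d j.+1 = b. Proof. by rewrite bT; apply: base_block; rewrite -?bT. Qed.

Let h := hh j.+1.
Let l := br ^+ 6 * h.
Let n := (b ^ m)./2.

Let n2 : n.*2 = (b ^ m)%N.
Proof.
rewrite /n even_halfK// bT !oddX /m addn_eq0 andbF orbF /=.
by move: T0; rewrite lt0n.
Qed.

Let lE : ell j.+1 = l.
Proof.
by rewrite /l /h /hh /grid_size base_j1 mulrC divfK// expf_neq0// gt_eqF.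
Qed.

Let ellE : ell j = n.*2%:R * l.
Proof.
by rewrite -lE /ell /= base_j n2 natrX mulrC divfK// expf_neq0// gt_eqF.
Qed.

Let hhE : hh j = br ^+ m * h.
Proof.
rewrite /hh /grid_size base_j -/ell ellE n2 natrX -/br /l.
by field; rewrite gt_eqF.
Qed.

Let h0 : 0 < h. Proof. exact: hh0. Qed.
Let l0 : 0 < l. Proof. by rewrite -lE. Qed.

Lemma block_cell_lt : ell j < a.
Proof.
have jlt : br < 2 ^+ j.
  rewrite -natrX ltr_nat; apply: (@leq_ltn_trans j); last exact: ltn_expl.
  case/andP: jb => h1 _; apply: leq_trans h1.
  by rewrite /E expnS leq_pmulr// expn_gt0 (leq_trans _ b12).
apply: (le_lt_trans (cell_size_le2 R d j)); rewrite exprVn.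
apply: (@lt_le_trans _ _ br^-1); first by rewrite ltf_pV2 ?posrE ?exprn_gt0.
by rewrite -[leLHS]mul1r ler_pdivrMr//; have := b_a; have := d1; lra.
Qed.

Let l_small : l * (4 * br ^+ 2) <= 1.
Proof.
rewrite -lE /ell /= base_j -/br.
have h4 := cell_size_le R d j.
have -> : br ^+ m = br ^+ 2 * br ^+ (m - 2) by rewrite -exprD subnKC ?m_ge.
rewrite mulrAC ler_pdivrMr ?mulr_gt0 ?exprn_gt0// mul1r mulrA mulrC ler_pM2l ?exprn_gt0//.
apply: (@le_trans _ _ 1); first by lra.
by rewrite exprn_ege1.
Qed.

Let l_le_ell : l <= ell j.
Proof.
by rewrite ellE ler_peMl ?(ltW l0)// ler1n n2 expn_gt0 (leq_trans _ b12).
Qed.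

Let h_le_l : h <= l.
Proof. by rewrite ler_peMl ?(ltW h0)// exprn_ege1. Qed.

Let f1 x y : unit_cube d x -> unit_cube d y -> `|x - y| <= l ->
  `|f x - f y| <= br * (`|x - y| + h).
Proof.
move=> xQ yQ xy; have n2d := norm2_le_norm (x - y).
have nl : norm2 (x - y) <= d%:R * l by rewrite (le_trans n2d)// ler_pM2l.
have la : d%:R * l < a.
  have : d%:R * l * (4 * br ^+ 2) <= d%:R by rewrite -mulrA ler_piMr// ltW.
  have : a * br <= a * br ^+ 2 by rewrite ler_pM2l// expr2 ler_peMl// ltW.
  rewrite -(@ltr_pM2r _ (br ^+ 2)) ?exprn_gt0//; have := b_a; have := d0; lra.
rewrite (le_trans (norm_le_norm2 _))// (le_trans (F1 jb1 xQ yQ (le_lt_trans nl la)))//.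
rewrite -mulrA ler_pM2l// ler_pdivrMl ?mulr_gt0// -/h.
have := mulr_ge0 (ltW d0) (normr_ge0 (x - y)).
have : h <= d%:R * h by rewrite ler_peMl// ltW.
have := h0; lra.
Qed.

Let f2 x y : unit_cube d x -> unit_cube d y -> `|x - y| <= l ->
  `|x - y| <= br * (`|f x - f y| + h).
Proof.
move=> xQ yQ xy; have fxy := f1 xQ yQ xy.
have n2d := norm2_le_norm (f x - f y).
have la : norm2 (f x - f y) < a.
  apply: (le_lt_trans n2d).
  have : d%:R * `|f x - f y| <= d%:R * (br * (2 * l)).
    rewrite ler_pM2l// (le_trans fxy)// ler_pM2l//; have := h_le_l; lra.
  have : l * (4 * br ^+ 2) * d%:R <= d%:R by rewrite ler_piMl// ltW.
  have := b_a; have := d0; have := br12; rewrite expr2 => h1 h2 h3 h4 h5.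
  apply: (le_lt_trans h5).
  rewrite -(ltr_pM2r br0); apply: lt_le_trans h3.
  have -> : d%:R * (br * (2 * l)) * br = l * (4 * (br * br)) * d%:R / 2 by field.
  lra.
rewrite (le_trans (norm_le_norm2 _))// (le_trans (F2 jb1 xQ yQ la))//.
rewrite -mulrA ler_pM2l// ler_pdivrMl ?mulr_gt0// -/h.
have := mulr_ge0 (ltW d0) (normr_ge0 (f x - f y)).
have : h <= d%:R * h by rewrite ler_peMl// ltW.
have := h0; lra.
Qed.

Variable p : 'rV[R]_d.
Hypothesis p_adm : admissible j p.

Let p_in i : 0 <= p 0 i /\ p 0 i + 2 * ell j <= 1.
Proof. by case: p_adm => _ _ + _; apply. Qed.

Lemma admissible_stretch_le : norm2 (f (p + ell j *: e1) - f p) <= br * ell j.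
Proof.
have pQ : unit_cube d p by move=> i; have := p_in i; have := ell0 j; lra.
have peQ : unit_cube d (p + ell j *: e1).
  move=> i; have := p_in i; have := ell0 j; rewrite !mxE eqxx /=.
  by case: (i == i1) => /=; rewrite ?mulr1 ?mulr0; lra.
have nE : norm2 (p + ell j *: e1 - p) = ell j by rewrite addrC addKr e1_norm// ltW.
have := F1 jb0 peQ pQ; rewrite nE => /(_ block_cell_lt) h1; apply: le_trans h1 _.
rewrite -mulrA ler_pM2l// ler_pdivrMl ?mulr_gt0//.
have := grid_size_le R d j; rewrite -/ell -/(hh j); have := ell0 j; have := d1; nra.
Qed.

(** Stage [j] is covered by its plateau, which starts at the lattice point [p 0 i2] and has width
    [2 * l]; earlier stages by admissibility, as [2 * l <= ell j]. *)
Let core_stripe y : p 0 i2 <= y <= p 0 i2 + 2 * l ->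
  forall n', (n' <= j)%N -> stripe ell hh n' y = 1.
Proof.
move=> py n'; rewrite leq_eqVlt => /predU1P[->|n'j].
  case: p_adm => _ [u pu] _ _.
  have -> : y = u%:R * hh j + (y - p 0 i2) by rewrite pu; ring.
  apply: stripe1 => //; first exact: cell_grid.
  by rewrite -/ell lE; lra.
case: p_adm => _ _ _; apply=> //.
have : 2 * l <= ell j.
  rewrite ellE ler_pM2r// ler_nat n2 /m addnC expnD expnS -mulnA.
  by rewrite (leq_trans (leq_trans _ b12))// leq_pmulr// muln_gt0 !expn_gt0 (leq_trans _ b12).
lra.
Qed.

Let unit_cube_cell i : (i < n.*2)%N -> cube (p + (i%:R * l) *: e1) l `<=` unit_cube d.
Proof.
move=> iN x px i'; have := px i'; have [p0 p1] := p_in i'.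
have il : i%:R * l <= ell j by rewrite ellE ler_pM2r// ler_nat ltnW.
have i0 : 0 <= i%:R * l by rewrite mulr_ge0// ltW.
have := l_le_ell; rewrite !mxE eqxx /=.
by case: (i' == i1) => /=; rewrite ?mulr1 ?mulr0; lra.
Qed.

Let no_match i : (i < n)%N -> forall w,
  ~ (forall x, cube (p + (i.*2%:R * l) *: e1 + const_mx (l / br ^+ 2)) (l - 2 * (l / br ^+ 2)) x ->
    (f @` cube (p + (i.*2%:R * l) *: e1 + l *: e1) l) (f x + w)).
Proof.
move=> iN w match_w; set q := p + (i.*2%:R * l) *: e1 in match_w.
have i2n : (i.*2 < n.*2)%N by rewrite ltn_double.
have i2n1 : (i.*2.+1 < n.*2)%N by rewrite -doubleS leq_double.
have eta0 : 0 <= l / br ^+ 2 by rewrite divr_ge0 ?exprn_ge0// ltW.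
have qA : cube (q + const_mx (l / br ^+ 2)) (l - 2 * (l / br ^+ 2)) `<=` unit_cube d.
  apply: subset_trans (unit_cube_cell i2n) => x xq i'.
  have := xq i'; rewrite [(q + _) 0 i']mxE [const_mx _ _ _]mxE -/q; lra.
have qB : cube (q + l *: e1) l `<=` unit_cube d.
  have -> : q + l *: e1 = p + (i.*2.+1%:R * l) *: e1.
    by rewrite /q -(natr1 i.*2) mulrDl mul1r scalerDl addrA.
  exact: unit_cube_cell.
have := pushforward_translate_le finj (continuous_subspaceT fc) fpush
  (@cube_compact _ _ _ _) (@cube_compact _ _ _ _) qA qB match_w.
rewrite leNgt => /negP; apply; rewrite -lE.
have [[u pu] [u2 pu2] _ _] := p_adm.
(* [p 0 i1] is a multiple of [hh j = b ^ (m - 6) * ell j.+1], hence an even multiple of the cell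
   side because [b] is even. So the cells at even positions from [p] are those where the wave is
   positive. *)
apply: (@cell_mass_lt R d i1 i2 ell hh amp i12 _ _ _ _ _ j (b ^ 6)%N
  ((u * b ^ (m - 6))./2 + i)%N (u2 * b ^ m)%N br q) => //.
- exact: cell_grid.
- exact: amplitude_ge0.
- exact: amplitude_le.
- exact: amplitude_small.
- by rewrite -/ell lE natrX.
- by rewrite /amp /amplitude base_j.
- have -> : ell j.+2 = l / br ^+ m by rewrite -lE /ell /= base_j1.
  rewrite -natr1 natrX -/br lE.
  have -> : (br ^+ 6 + 1) * (4 * (l / br ^+ m)) = (4 * (br ^+ 6 + 1) / br ^+ m) * l.
    by field; rewrite expf_neq0// gt_eqF.
  rewrite [leRHS]mulrC ler_pM2r// ler_pdivrMr ?exprn_gt0//.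
  have mE : m = (2 + (7 + (m - 9)))%N by rewrite addnA subnKC ?m_ge.
  have -> : br ^- 2 * br ^+ m = br ^+ 7 * br ^+ (m - 9).
    by rewrite {1}mE exprD mulKf ?expf_neq0 ?gt_eqF// exprD.
  apply: (@le_trans _ _ (br ^+ 7)); last by rewrite ler_peMr ?exprn_ge0 ?(ltW br0)// exprn_ege1.
  rewrite exprS; have : 1 <= br ^+ 6 by rewrite exprn_ege1.
  have := br12; nra.
- rewrite /q !mxE !eqxx mulr1 pu hhE.
  have ev : ~~ odd (u * b ^ (m - 6)).
    rewrite oddM oddX bT oddX /= subn_eq0 leqNgt m_ge//=.
    by move: T0; rewrite lt0n => /negbTE ->; rewrite andbF.
  rewrite doubleD even_halfK// natrD natrM natrX -/br lE /l.
  have mE : m = (m - 6 + 6)%N by rewrite subnK ?m_ge.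
  by rewrite {1}mE exprD; ring.
- rewrite /q !mxE pu2 hhE natrM natrX -/br -/h eqxx (eq_sym i2) (negbTE i12) mulr0 addr0.
  by rewrite mulrA.
- move=> y qy; apply: core_stripe; have := l0; move: qy.
  rewrite -/ell lE /q !mxE eqxx eq_sym (negbTE i12) mulr0 addr0; lra.
Qed.

(** The stretched segment starts at a node, and nodes inherit admissibility: they are on the lattice
    of step [hh j.+1], and are displaced in direction [i2] by at most [l], half of the plateau of
    stage [j]. *)
Lemma admissible_step A : 0 < A -> A * ell j <= norm2 (f (p + ell j *: e1) - f p) ->
  exists2 p', admissible j.+1 p' &
    (1 + k) * A * ell j.+1 <= norm2 (f (p' + ell j.+1 *: e1) - f p').
Proof.
move=> A0 p_stretch.
have Ab : A <= br by rewrite -(ler_pM2r (ell0 j)) (le_trans p_stretch)// admissible_stretch_le.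
have p_in' i : 0 <= p 0 i /\ p 0 i + 2 * (n.*2%:R * (b%:R ^+ 6 * h)) <= 1.
  by rewrite -/br -/l -ellE; exact: p_in.
rewrite ellE in p_stretch.
have [i [s [iN]]] := longer_increment h0 A0 Ab n2 b_large b12 fc f1 f2 p_in' p_stretch no_match.
rewrite -/br -/l -/e1 -/k => st.
exists (p + (i%:R * l) *: e1 + \row_i (h * (s i)%:R)); last by rewrite lE.
have hs c : 0 <= h * (s c)%:R <= l.
  rewrite mulr_ge0 ?(ltW h0)//= /l mulrC ler_pM2r// -natrX ler_nat -ltnS.
  exact: ltn_ord.
have [[u pu] [u2 pu2] _ _] := p_adm.
have two_l : 2 * l <= ell j.
  rewrite ellE ler_pM2r// ler_nat n2 /m addnC expnD expnS -mulnA.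
  by rewrite (leq_trans (leq_trans _ b12))// leq_pmulr// muln_gt0 !expn_gt0 (leq_trans _ b12).
split.
- exists (u * b ^ m + i * b ^ 6 + s i1)%N.
  rewrite !mxE !eqxx mulr1 pu hhE -/h !natrD !natrM !natrX -/br /l.
  by ring.
- exists (u2 * b ^ m + s i2)%N.
  rewrite !mxE eqxx (eq_sym i2) (negbTE i12) mulr0 addr0 pu2 hhE -/h natrD natrM natrX -/br.
  by ring.
- move=> c; have := hs c; have [p0 p1] := p_in c; rewrite lE !mxE eqxx /=.
  have il : (i.+1)%:R * l <= ell j by rewrite ellE ler_pM2r// ler_nat.
  rewrite -(natr1 i) mulrDl mul1r in il.
  have i0 : 0 <= i%:R * l by rewrite mulr_ge0// ltW.
  have := l0; case: (c == i1) => /=; rewrite ?mulr1 ?mulr0; lra.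
- move=> y; rewrite lE !mxE eqxx (eq_sym i2) (negbTE i12) mulr0 addr0 => py n'.
  by rewrite ltnS => n'j; apply: core_stripe => //; have := hs i2; lra.
Qed.

End block.

(** The origin is the left end of a plateau of every stage. The lower bound on the stretch comes
    from the inverse map, or from [ell (b ^ E) < a] if the image points are at distance at least
    [a]. *)
Lemma initial_stretch : exists2 p, admissible (b ^ E) p &
  br^-1 * ell (b ^ E) <= norm2 (f (p + ell (b ^ E) *: e1) - f p).
Proof.
have jb : (b ^ E <= b ^ E <= 2 * b ^ E)%N by rewrite leqnn mul2n -addnn leq_addr.
have jb0 : (b ^ E <= b ^ E <= 2 * b ^ E + 1)%N by rewrite leqnn mul2n -addnn -addnA leq_addr.
have ell4 := cell_size_le R d (b ^ E).
have l0 := ell0 (b ^ E).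
exists 0.
  split; try by exists 0%N; rewrite mxE mul0r.
    by move=> i; rewrite mxE; rewrite -/ell in ell4; split; lra.
  move=> y; rewrite mxE add0r => /andP[y0 y1] n nj.
  rewrite -[y]add0r -[X in X + y](mul0r (hh n)).
  apply: (@stripe1 R ell hh _ _ n 0%N) => //; first exact: cell_grid.
  have := cell_size_anti R d nj; rewrite -/ell y0/=; have := ell0 n.+1; lra.
rewrite add0r; set X := norm2 _.
have Q0 : unit_cube d (0 : 'rV[R]_d) by move=> i; rewrite mxE lexx ler01.
have Qe : unit_cube d (ell (b ^ E) *: e1).
  move=> i; rewrite -/ell in ell4; rewrite !mxE eqxx /=.
  by case: (i == i1) => /=; rewrite ?mulr1 ?mulr0; lra.
have [Xa|aX] := ltP X a; last first.
  apply: le_trans aX; rewrite (le_trans _ (ltW (block_cell_lt jb)))//.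
  by rewrite ler_piMl ?(ltW l0)// invf_le1.
have := F2 jb0 Qe Q0 Xa; rewrite subr0 e1_norm ?(ltW l0)// -/X => h1.
rewrite leNgt; apply/negP => Xl; move: h1; apply/negP; rewrite -ltNge.
have hl : hh (b ^ E) <= br^-1 * ell (b ^ E).
  rewrite /hh /grid_size bT (base_block T0) -?bT//.
  rewrite mulrC ler_pM2r// lef_pV2 ?posrE ?exprn_gt0//.
  by rewrite -[leLHS]expr1 ler_weXn2l.
apply: (@lt_le_trans _ _ (br / (2 * d%:R) * (2 * (br^-1 * ell (b ^ E))))).
  by rewrite ltr_pM2l ?divr_gt0 ?mulr_gt0//; lra.
have -> : br / (2 * d%:R) * (2 * (br^-1 * ell (b ^ E))) = ell (b ^ E) / d%:R.
  by field; rewrite !gt_eqF.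
by rewrite ler_pdivrMr// ler_peMr// ltW.
Qed.

Lemma no_coarse_realization : False.
Proof.
have b0 : (0 < b)%N by exact: leq_trans b12.
have k0 : 0 < k by rewrite invr_gt0 exprn_gt0.
have stretch i : (i <= b ^ E)%N -> exists2 p, admissible (b ^ E + i) p &
    (1 + k) ^+ i / br * ell (b ^ E + i) <= norm2 (f (p + ell (b ^ E + i) *: e1) - f p).
  elim: i => [_|i IH iE].
    by rewrite addn0 expr0 mul1r; exact: initial_stretch.
  have [|p p_adm st] := IH; first exact: ltnW.
  have jb : (b ^ E <= b ^ E + i <= 2 * b ^ E)%N.
    by rewrite leq_addr mul2n -addnn leq_add2l ltnW.
  have A0 : 0 < (1 + k) ^+ i / br by rewrite divr_gt0// exprn_gt0// addr_gt0.
  have [p' p'_adm st'] := admissible_step jb p_adm A0 st.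
  by exists p'; rewrite addnS// exprS -[_ * _ / br]mulrA.
have [p p_adm st] := stretch _ (leqnn _).
have jb : (b ^ E <= b ^ E + b ^ E <= 2 * b ^ E)%N by rewrite leq_addr mul2n -addnn leqnn.
have := le_trans st (admissible_stretch_le jb p_adm).
rewrite ler_pM2r// ler_pdivrMr//; apply/negP; rewrite -ltNge -expr2.
(* The growth over the stages is at least [1 + b ^ E * b ^- m = 1 + b ^ 2], which explains
   [E = m + 2]. *)
have /(bernoulli (b ^ E)) : -1 <= k by lra.
apply: lt_le_trans.
have -> : (b ^ E)%:R * k = br ^+ 2.
  by rewrite natrX -/br /k /E -addn2 exprD mulrAC mulfV ?mul1r// expf_neq0// gt_eqF.
by rewrite ltrDr.
Qed.

End iteration.

(** * Moduli of continuity *)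

Section log_modulus.
Variables (R : realType) (a alpha : R) (omega : R -> R).
Hypotheses (alpha0 : 0 < alpha) (alpha1 : alpha <= 1).
Hypothesis omegaE : forall t, 0 < t < a -> omega t = t * ln (1 / t) `^ alpha.

(** For [t >= h] the logarithm is monotone. For [t < h], [ln (1 / t) = ln (h / t) + ln (1 / h) <= h
    / t * ln (1 / h)], both [h / t] and [ln (1 / h)] being at least [1]; since [alpha <= 1], the
    power does not enlarge the factor [h / t]. *)
Lemma log_modulus_le h t : 0 < h -> 1 <= ln (1 / h) -> 0 < t -> t < a -> t < 1 ->
  omega t <= ln (1 / h) `^ alpha * (h + t).
Proof.
move=> h0 lnh t0 ta t1; rewrite omegaE ?t0// mulrDr.
have L0 : 0 <= ln (1 / h) by apply: le_trans lnh.
have lnt : 0 <= ln (1 / t) by rewrite div1r ln_ge0// invf_ge1// ltW.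
have [th|ht] := ltP t h; last first.
  rewrite mulrC; apply: (@le_trans _ _ (ln (1 / h) `^ alpha * t)).
    rewrite ler_pM2r//; apply: ge0_ler_powR; rewrite ?nnegrE ?(ltW alpha0)//.
    by rewrite ler_ln ?posrE ?divr_gt0// !div1r lef_pV2.
  by rewrite lerDr mulr_ge0 ?powR_ge0// ltW.
apply: (@le_trans _ _ (ln (1 / h) `^ alpha * h)); last first.
  by rewrite lerDl mulr_ge0 ?powR_ge0// ltW.
have ht1 : 1 <= h / t by rewrite ler_pdivlMr// mul1r ltW.
have ln_le : ln (1 / t) <= h / t * ln (1 / h).
  have -> : 1 / t = h / t * (1 / h) by field; rewrite !gt_eqF.
  rewrite lnM ?posrE ?divr_gt0//.
  have := ln_le_sub1 (lt_le_trans ltr01 ht1); nra.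
have : ln (1 / t) `^ alpha <= h / t * ln (1 / h) `^ alpha.
  apply: (@le_trans _ _ ((h / t * ln (1 / h)) `^ alpha)).
    apply: ge0_ler_powR; rewrite ?nnegrE ?(ltW alpha0)//.
    by rewrite mulr_ge0// divr_ge0// ltW.
  rewrite powRM//; last by rewrite divr_ge0// ltW.
  by rewrite ler_wpM2r ?powR_ge0// ler1_powR.
rewrite -(ler_pM2l t0) => /le_trans; apply.
by rewrite mulrA mulrCA mulfV ?gt_eqF// mulr1 mulrC.
Qed.

(** Distances are kept below [1] so that the logarithm in the modulus is nonnegative. *)
Lemma omega_mapping_coarse n k (A : set 'rV[R]_n) (g : 'rV[R]_n -> 'rV[R]_k) :
  omega_mapping a omega A g -> exists2 K, 0 < K & forall h x y, 0 < h -> 1 <= ln (1 / h) ->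
    A x -> A y -> norm2 (x - y) < Num.min a 1 ->
    norm2 (g x - g y) <= K * ln (1 / h) `^ alpha * (h + norm2 (x - y)).
Proof.
move=> [K K0 gK]; exists K => // h x y h0 lnh Ax Ay; rewrite lt_min => /andP[xa x1].
have [->|xy] := eqVneq x y.
  rewrite !subrr.
  have -> : norm2 (0 : 'rV[R]_k) = 0 by apply/eqP; rewrite norm2_eq0.
  by rewrite mulr_ge0 ?mulr_ge0 ?powR_ge0 ?(ltW K0)// addr_ge0 ?norm2_ge0// ltW.
have xy0 : 0 < norm2 (x - y) by rewrite norm2B_gt0.
rewrite (le_trans (gK y x Ay Ax _)) ?xy0// -mulrA ler_pM2l//.
exact: log_modulus_le.
Qed.

End log_modulus.

(** * Continuous extension of a realization to the whole space *)

Section clamp.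
Variables (R : realType) (d : nat).

(** Precomposition with this retraction turns a realization into a map continuous everywhere,
    unchanged on the cube. *)
Definition clamp (v : 'rV[R]_d) : 'rV[R]_d := \row_i Num.max 0 (Num.min 1 (v 0 i)).

Lemma clamp_in v : unit_cube d (clamp v).
Proof. by move=> i; rewrite mxE le_max lexx/= ge_max ler01/= ge_min lexx. Qed.

Lemma clamp_id v : unit_cube d v -> clamp v = v.
Proof.
move=> vQ; apply/rowP => i; rewrite mxE; have /andP[v0 v1] := vQ i.
by rewrite min_r// max_r.
Qed.

Lemma clamp_lipschitz u v : `|clamp u - clamp v| <= `|u - v|.
Proof.
apply: norm_rV_le => // i; apply: le_trans (coord_le_norm (u - v) i).
rewrite !mxE; move: (u 0 i) (v 0 i) => x y.
wlog xy : x y / x <= y => [hw|].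
  by have [/hw//|/ltW/hw] := leP x y; rewrite distrC (distrC y).
have mono (z w : R) : z <= w -> Num.max 0 (Num.min 1 z) <= Num.max 0 (Num.min 1 w).
  move=> zw; rewrite ge_max le_max lexx/= le_max; apply/orP; right.
  by rewrite le_min ge_min lexx/= ge_min zw orbT.
rewrite distrC (distrC x) !ger0_norm ?subr_ge0 ?mono//.
rewrite /Num.max /Num.min; do ?case: ifPn; rewrite ?lt_def -?leNgt; lra.
Qed.

End clamp.

Section realization.
Variables (R : realType) (d : nat) (a alpha K : R) (f : 'rV[R]_d -> 'rV[R]_d).
Hypotheses (d0 : (0 < d)%N) (a0 : 0 < a) (K0 : 0 < K).
Hypotheses (alpha0 : 0 < alpha) (alpha1 : alpha <= 1).
Hypothesis fK : forall h x y, 0 < h -> 1 <= ln (1 / h) ->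
  unit_cube d x -> unit_cube d y -> norm2 (x - y) < a ->
  norm2 (f x - f y) <= K * ln (1 / h) `^ alpha * (h + norm2 (x - y)).

(** With mesh [h = s ^ 2] and distances at most [s ^ 2], the coarse bound is at most [4 * K * s],
    since [ln (1 / s ^ 2) <= 2 / s]. *)
Lemma clamp_continuous : continuous (f \o @clamp R d).
Proof.
move=> x; apply/(@cvgrPdist_lt _ _ _ (nbhs x)) => /= e e0.
pose s := Num.min (Num.min 2^-1 (a / 2)) (e / (8 * K)).
have s0 : 0 < s.
  rewrite !lt_min; apply/andP; split; last by rewrite divr_gt0 ?mulr_gt0.
  by rewrite invr_gt0 divr_gt0 ?ltr0n.
have s12 : s <= 2^-1 by rewrite !ge_min lexx.
have sa : s <= a / 2 by rewrite !ge_min lexx orbT.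
have se : s <= e / (8 * K) by rewrite !ge_min lexx orbT.
have dR : 0 < d%:R :> R by rewrite ltr0n.
have h0 : 0 < s ^+ 2 by rewrite exprn_gt0.
have ss : s ^+ 2 <= s / 2 by rewrite expr2 ler_pM2l.
have ln1 : 1 <= ln (1 / s ^+ 2).
  apply: le_trans (ln4_ge1 R) _; rewrite div1r ler_ln ?posrE ?invr_gt0//.
  by rewrite -[leLHS]invrK lef_pV2 ?posrE ?invr_gt0//; lra.
apply/nbhs_ballP; exists (s ^+ 2 / d%:R) => /=; first by rewrite divr_gt0.
move=> y; rewrite -ball_normE /= ltr_pdivlMr// => xy.
have n2 : norm2 (clamp x - clamp y) <= s ^+ 2.
  rewrite (le_trans (norm2_le_norm _))// (le_trans _ (ltW xy))// mulrC.
  by rewrite ler_pM2r// clamp_lipschitz.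
rewrite (le_lt_trans (norm_le_norm2 _))//.
have n2a : norm2 (clamp x - clamp y) < a by apply: (le_lt_trans n2); lra.
apply: (le_lt_trans (fK h0 ln1 (clamp_in x) (clamp_in y) n2a)).
have lna : ln (1 / s ^+ 2) `^ alpha <= 2 / s.
  apply: (@le_trans _ _ (ln (1 / s ^+ 2))); first exact: ler1_powR.
  rewrite div1r -exprVn lnXn ?invr_gt0// -[ln _ *+ _]mulr_natl ler_pM2l//.
  by rewrite (le_trans (ln_le_sub1 _)) ?invr_gt0// gerBl.
apply: (@le_lt_trans _ _ (K * (2 / s) * (2 * s ^+ 2))).
  apply: ler_pM.
  - by rewrite mulr_ge0 ?powR_ge0// ltW.
  - by rewrite addr_ge0 ?norm2_ge0// ltW.
  - by rewrite ler_pM2l.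
  - by move: n2; lra.
have -> : K * (2 / s) * (2 * s ^+ 2) = 4 * K * s by field; rewrite gt_eqF.
move: se; rewrite ler_pdivlMr ?mulr_gt0//; nra.
Qed.

End realization.

(** * Calibration of the exponent against the scales *)

(** Origin of the exponent: the logarithm is at most of order [b ^ E.+1] for [b = 2 ^ T], and the
    power [1 / (2 * E.+1)] brings it down to [sqrt b]. *)
Lemma log_power_le (R : realType) d T j : (0 < T)%N ->
  let E := (6 * d + 14).+2 in
  ((2 ^ T) ^ E <= j <= 2 * (2 ^ T) ^ E + 1)%N ->
  ln (1 / @grid_size R d j) `^ (2 * E.+1%:R)^-1 <=
  (3 * (6 * d + 14) + 8)%:R * Num.sqrt ((2 ^ T)%:R).
Proof.
move=> T0 E jT.
have b0 : 0 <= (2 ^ T)%:R :> R by [].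
have al0 : 0 <= (2 * E.+1%:R)^-1 :> R by rewrite invr_ge0 mulr_ge0.
have al1 : (2 * E.+1%:R)^-1 <= 1 :> R.
  by rewrite invf_le1 ?mulr_gt0// -natrM ler1n.
set C := (3 * (6 * d + 14) + 8)%N.
have C1 : 1 <= C%:R :> R by rewrite ler1n /C addn_gt0 orbT.
apply: (@le_trans _ _ ((C%:R * (2 ^ T)%:R ^+ E.+1) `^ (2 * E.+1%:R)^-1)).
  apply: ge0_ler_powR => //; last exact: ln_grid_le.
    by rewrite nnegrE (le_trans ler01)// ln_grid_ge1.
  by rewrite nnegrE mulr_ge0// exprn_ge0.
rewrite powRM ?exprn_ge0//; apply: ler_pM; rewrite ?powR_ge0//.
  by rewrite ler1_powR.
rewrite -powR_mulrn// -powRrM -powR12_sqrt//.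
by rewrite (_ : E.+1%:R * _ = 2^-1)//; field.
Qed.

Lemma nat_upper_bound n0 n1 n2 n3 n4 :
  exists T, [/\ n0 <= T, n1 <= T, n2 < T, n3 < T & n4 < T]%N.
Proof. by exists (n0 + n1 + n2 + n3 + n4).+1; split; lia. Qed.

Theorem theorem1p6 (R : realType) (d : nat) (hd : (2 <= d)%N) :
  exists2 alpha0 : R, 0 < alpha0 &
  forall (a : R) (omega : R -> R),
    0 < a ->
    (forall t : R, 0 < t < a -> 0 < omega t) ->
    {in `]0, a[ &, injective omega} ->
    (forall t : R, 0 < t < a -> omega t = t * ln (1 / t) `^ alpha0) ->
  exists rho : 'rV[R]_d -> R,
    [/\ {within unit_cube d, continuous rho},
        (forall x, unit_cube d x -> 0 < rho x) &
        ~ exists f : 'rV[R]_d -> 'rV[R]_d,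
            [/\ set_inj (unit_cube d) f,
                bi_omega_mapping a omega (unit_cube d) f &
                pushforward_equation rho f]].
Proof.
set E := (6 * d + 14).+2.
pose alpha : R := (2 * E.+1%:R)^-1.
have al0 : 0 < alpha by rewrite invr_gt0 mulr_gt0 ?ltr0n.
have al1 : alpha <= 1.
  by rewrite invf_le1 ?mulr_gt0 ?ltr0n// -natrM ler1n.
exists alpha => // a omega a0 _ _ omegaE.
have d0 : (0 < d)%N by rewrite ltnW.
pose i1 : 'I_d := Ordinal d0; pose i2 : 'I_d := Ordinal hd.
have i12 : i1 != i2 by [].
pose rho (v : 'rV[R]_d) := wave_density (@cell_size R d) (@grid_size R d) (@amplitude R d)
  (v 0 i1) (v 0 i2).
exists rho; split.
- apply: continuous_subspaceT; apply: wave_density_continuous.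
  + exact: amplitude_ge0.
  + exact: amplitude_le.
  + exact: amplitude_small.
- move=> x _; apply: lt_le_trans ltr01 _; apply: wave_density_ge1.
  + exact: amplitude_ge0.
  + exact: amplitude_le.
move=> [f [fi [_ fom finvom] fpush]].
have [K1 K10 fK1] := omega_mapping_coarse al0 al1 omegaE fom.
have [K2 K20 finvK2] := omega_mapping_coarse al0 al1 omegaE finvom.
pose K := Num.max K1 K2; have K0 : 0 < K by rewrite lt_max K10.
set a' := Num.min a 1 in fK1 finvK2.
have a'0 : 0 < a' by rewrite lt_min a0 ltr01.
have weaken K' h t n : K' <= K -> 0 < h -> n <= K' * ln (1 / h) `^ alpha * (h + norm2 t) ->
    n <= K * ln (1 / h) `^ alpha * (h + norm2 (t : 'rV[R]_d)).
  move=> K'K h0 /le_trans; apply; rewrite ler_wpM2r ?addr_ge0 ?norm2_ge0 ?(ltW h0)//.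
  by rewrite ler_wpM2r ?powR_ge0.
have fK h x y : 0 < h -> 1 <= ln (1 / h) -> unit_cube d x -> unit_cube d y ->
    norm2 (x - y) < a' -> norm2 (f x - f y) <= K * ln (1 / h) `^ alpha * (h + norm2 (x - y)).
  move=> h0 lnh xQ yQ xy; apply: (weaken K1) => //; first by rewrite le_max lexx.
  exact: fK1.
have finvK h x y : 0 < h -> 1 <= ln (1 / h) -> unit_cube d x -> unit_cube d y ->
    norm2 (f x - f y) < a' -> norm2 (x - y) <= K * ln (1 / h) `^ alpha * (h + norm2 (f x - f y)).
  move=> h0 lnh xQ yQ xy; apply: (weaken K2) => //; first by rewrite le_max lexx orbT.
  have := finvK2 h (f x) (f y) h0 lnh (imageP f xQ) (imageP f yQ) xy.
  by rewrite !pinvKV// inE.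
have f'E x : unit_cube d x -> (f \o @clamp R d) x = f x by move=> xQ /=; rewrite clamp_id.
set C := (3 * (6 * d + 14) + 8)%N.
pose c0 := cos (pi / 4 : R).
have c00 : 0 < c0 by rewrite cos_gt0_pihalf//; have := pi_gt0 R; lra.
have dR : 0 < d%:R :> R by rewrite ltr0n.
(* [r1 <= b] serves the comparison of masses, [r2 <= b] keeps the cells shorter than [a'], and
   [r3 ^+ 2 <= b] bounds the coarse Lipschitz constant [K * C * sqrt b] by [b / (2 * d)]. *)
pose r1 : R := (8 * d%:R + 8) / c0.
pose r2 : R := 2 * d%:R / a'.
pose r3 : R := K * C%:R * (2 * d%:R).
have [T [T12 Td T1 T2 T3]] : exists T, [/\ (12 <= T)%N, (2 ^ d.+3 * (8 * d + 2) <= T)%N,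
    (Num.trunc r1 < T)%N, (Num.trunc r2 < T)%N & (Num.trunc (r3 ^+ 2)%R < T)%N].
  exact: nat_upper_bound.
have [b bT] : exists b, b = (2 ^ T)%N by exists (2 ^ T)%N.
have Tb : (T <= b)%N by rewrite bT ltnW// ltn_expl.
have trunc_b (r : R) : ((Num.trunc r).+1 <= T)%N -> r <= b%:R.
  move=> rT; rewrite (le_trans (ltW (truncnS_gt r)))// ler_nat.
  exact: leq_trans Tb.
have T0 : (0 < T)%N by rewrite (leq_trans _ T12).
have b_coarse j : (b ^ E <= j <= 2 * b ^ E + 1)%N ->
    K * ln (1 / @grid_size R d j) `^ alpha <= b%:R / (2 * d%:R).
  rewrite bT => jb; rewrite ler_pdivlMr ?mulr_gt0//.
  have := log_power_le R T0 jb; rewrite -bT -/alpha -/C => h.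
  apply: (@le_trans _ _ (K * (C%:R * Num.sqrt b%:R) * (2 * d%:R))).
    by rewrite ler_pM2r ?mulr_gt0// ler_pM2l.
  rewrite (_ : _ * (2 * d%:R) = r3 * Num.sqrt b%:R); last by rewrite /r3; ring.
  rewrite -[leRHS](@sqr_sqrtr _ b%:R)// expr2 ler_wpM2r ?sqrtr_ge0//.
  have r30 : 0 <= r3 by rewrite !mulr_ge0// ltW.
  by rewrite -[leLHS](ger0_norm r30) -sqrtr_sqr ler_wsqrtr// trunc_b.
apply: (@no_coarse_realization R d i1 i2 (f \o @clamp R d) T b a') => //.
- exact: leq_trans Tb.
- exact: leq_trans Tb.
- by rewrite -/c0 [leRHS]mulrC -ler_pdivrMr// trunc_b.
- by rewrite [leRHS]mulrC -ler_pdivrMr// trunc_b.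
- exact: clamp_continuous fK.
- move=> x y /set_mem xQ /set_mem yQ; rewrite !f'E//.
  by apply: fi; exact: mem_set.
- move=> S mS; have := fpush S mS.
  rewrite (_ : (f \o @clamp R d) @` unit_cube d = f @` unit_cube d); last first.
    by apply: eq_imagel => x xQ; rewrite f'E.
  move=> <-; rewrite /pushforward /density_measure; congr integral.
  by apply/seteqP; split => x [xQ]; rewrite /= clamp_id.
- move=> j jb x y xQ yQ xy; rewrite !f'E//.
  apply: le_trans (fK _ _ _ (grid_size_gt0 R d j) (ln_grid_ge1 R d j) xQ yQ xy) _.
  by rewrite ler_wpM2r ?b_coarse// addr_ge0 ?norm2_ge0// ltW// grid_size_gt0.
- move=> j jb x y xQ yQ; rewrite !f'E// => xy.
  apply: le_trans (finvK _ _ _ (grid_size_gt0 R d j) (ln_grid_ge1 R d j) xQ yQ xy) _.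
  by rewrite ler_wpM2r ?b_coarse// addr_ge0 ?norm2_ge0// ltW// grid_size_gt0.
Qed.
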